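(* Let $\mathcal{C}$ be a fixed Hurwitz algebra and let $\mathcal{L}=\mathcal{T}(\mathcal{C})$. Then, up to graded isomorphism, there are exactly $215$ non-isomorphic Lie algebras in the set $$\{\mathcal{L}_T : T \text{ is a generalised nice set}\}.$$ A list of representatives is given by the algebras $\mathcal{L}_T$ with $T$ in the following list (a string of digits denotes the subset of $I$ consisting of these digits): (1) $Y_7, Y_{10}, Y_{11}, Y_{15}, Y_{19}, Y_{26}$ and $X_0$; (2) $P_{\{0,1,1\}}$, $S_1\cup P_{\{0,3,3\}}$, $S_2\cup P_{\{0,4,4\}}$, $S_3\cup P_{\{0,3,3\}}$, $S_6\cup P_{\{0,7,7\}}$, $S_7\cup P_{\{0,4,4\}}$ and $S_{10}\cup P_{\{0,4,4\}}$; (3) $E_J$ and $F_J$ for $J=\emptyset,1,12,123,1234,12345,123456,I$; (4) $S_i\cup E_J$ for: - $i=1$, $J=\emptyset,1,3,12,13,34,123,134,346,1234,3467,1367,12346,13467,123467$; - $i=2$, $J=\emptyset,1,2,4,12,14,23,24,47,123,124,234,247,147,1234,1247,2347,12347$; - $i=3$, $J=\emptyset,1,3,12,13,16,34,123,126,134,136,1234,1267,1236,1346,12346,12367,123467$; - $i=4$, $J=\emptyset,1,2,12,23,123,234,1234$; - $i=6$, $J=\emptyset,1,7,12,17,126,127,1267$; - $i=7$, $J=\emptyset,1,2,4,12,14,16,17,24,27,124,126,127,146,247,147,1267,1246,1247,12467$; - $i=8$, $J=\emptyset,2,23,25,234,235,2356,2345,23456,234567$; - $i=9$, $J=\emptyset,1,2,7,12,17,26,27,126,127,267,1267$;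 - $i=10$, $J=\emptyset,1,4,12,14,17,124,126,147,1267,1246,12467$; - $i=11$, $J=\emptyset,1,6,12,16,67,126,167,1267$; - $i=12$, $J=\emptyset,3,34,346,3467$; - $i=13$, $J=\emptyset,1,12,123$; (5) $S_i\cup F_J$ for: - $i=1$, $J=\emptyset,3,34,125,347,3467,1235,12567,123456,I$; - $i=2$, $J=\emptyset,4,47,12356,123456,I$; - $i=3$, $J=\emptyset,3,34,12567,123567,I$; - $i=4,8,9,11,12,13$, $J=\emptyset,I$; - $i=6$, $J=\emptyset,7,123456,I$; - $i=7,10$, $J=\emptyset,4,123567,I$.
   Context: $\mathbb{F}$ is an algebraically closed field of characteristic zero. $G=\mathbb{Z}_2^3$ has elements $g_0=(0,0,0)$, $g_1=(1,0,0)$, $g_2=(0,1,0)$, $g_3=(0,0,1)$, $g_4=(1,1,1)$, $g_5=(1,1,0)$, $g_6=(1,0,1)$, $g_7=(0,1,1)$. Put $I=\{1,\dots,7\}$, $I_0=I\cup\{0\}$, and define $i*j\in I_0$ by $g_i+g_j=g_{i*j}$. Octonions: $\mathcal{O}$ is the $\mathbb{F}$-algebra with basis $e_0=1,e_1,\dots,e_7$, $e_i^2=-1$ ($i\in I$), $e_ie_j=-e_je_i$ for distinct $i,j\in I$, and $e_ie_j=e_k$, $e_je_k=e_i$, $e_ke_i=e_j$ for $(i,j,k)\in\{(1,2,5),(5,6,7),(7,4,1),(1,3,6),(6,4,2),(2,7,3),(4,5,3)\}$. The involution $a\mapsto\bar a$ fixes $e_0$ and negates $e_i$, $i\in I$;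 the trace $t$ is defined by $t(a)1=a+\bar a$; $\mathcal{O}_0=\{a: t(a)=0\}$; $[a,b]=ab-ba$; $l_a(b)=ab$, $r_a(b)=ba$; $D_{a,b}=[l_a,l_b]+[l_a,r_b]+[r_a,r_b]\in\mathfrak{der}(\mathcal{O})$. A Hurwitz algebra $\mathcal{C}$ is one of the subalgebras $\mathcal{F}=\langle e_0\rangle$, $\mathcal{K}=\langle e_0,e_1\rangle$, $\mathcal{H}=\langle e_0,e_1,e_2,e_5\rangle$, $\mathcal{O}$. Given $\mathcal{C}$, $\mathcal{J}=\{u\in\mathcal{M}_3(\mathcal{C}):\bar u^t=u\}$ with product $u\cdot v=\frac12(uv+vu)$, $\mathrm{tr}(u)=\sum_i u_{ii}\in\mathbb{F}$, $\mathcal{J}_0=\{u:\mathrm{tr}(u)=0\}$, $u*v=u\cdot v-\frac13\mathrm{tr}(u\cdot v)1$ on $\mathcal{J}_0$, $R_u(v)=v\cdot u$. Then $\mathcal{L}=\mathcal{T}(\mathcal{C})=\mathfrak{der}(\mathcal{O})\oplus(\mathcal{O}_0\otimes\mathcal{J}_0)\oplus\mathfrak{der}(\mathcal{J})$ is the Lie algebra in which $\mathfrak{der}(\mathcal{O})$, $\mathfrak{der}(\mathcal{J})$ are commuting subalgebras, $[d,a\otimes u]=d(a)\otimes u$, $[D,a\otimes u]=a\otimes D(u)$, and $[a\otimes u,b\otimes v]=\frac13\mathrm{tr}(u\cdot v)D_{a,b}+[a,b]\otimes(u*v)+2t(ab)[R_u,R_v]$ (for $d\in\mathfrak{der}(\mathcal{O})$,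 $D\in\mathfrak{der}(\mathcal{J})$, $a,b\in\mathcal{O}_0$, $u,v\in\mathcal{J}_0$). It is simple of type $F_4,E_6,E_7,E_8$ for $\mathcal{C}=\mathcal{F},\mathcal{K},\mathcal{H},\mathcal{O}$. It is $G$-graded: $\mathcal{L}_0=\mathfrak{der}(\mathcal{J})$ has degree $g_0$, and for $i\in I$ the component of degree $g_i$ is $\mathcal{L}_i=\mathcal{D}_i\oplus\mathcal{M}_i$, where $\mathcal{D}_i=\{d\in\mathfrak{der}(\mathcal{O}): d(e_j)\in\mathbb{F}e_{i*j}\ \forall j\in I_0\}$ and $\mathcal{M}_i=e_i\otimes\mathcal{J}_0$. Generalised nice sets: $X_0$ is the set of all unordered pairs $\{i,j\}$, $i,j\in I_0$ (possibly $i=j$), and $ij$ abbreviates $\{i,j\}$. For $i,j,k\in I_0$ (possibly repeated), $P_{\{i,j,k\}}=\{\{i,j\},\{j,k\},\{k,i\},\{i,j*k\},\{j,k*i\},\{k,i*j\}\}$. A subset $T\subseteq X_0$ is a generalised nice set if for all $i,j,k\in I_0$, $\{i,j\},\{i*j,k\}\in T$ implies $P_{\{i,j,k\}}\subseteq T$. For such $T$, let $\varepsilon^T_{ij}=1$ if $\{i,j\}\in T$ and $0$ otherwise; $\mathcal{L}_T$ is the $G$-graded Lie algebra with underlying graded space $\mathcal{L}$ and bracket $[x,y]^{\varepsilon^T}=\varepsilon^T_{ij}[x,y]$ for $x\in\mathcal{L}_i$, $y\in\mathcal{L}_j$. A graded isomorphism $f:\mathcal{L}_T\to\mathcal{L}_{T'}$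 is a Lie algebra isomorphism such that for every $i\in I_0$ there is $k\in I_0$ with $f(\mathcal{L}_i)=\mathcal{L}_k$. Notation for sets: $S_1=\{12\}$, $S_2=\{12,13\}$, $S_3=\{12,67\}$, $S_4=\{12,13,14\}$, $S_6=\{12,16,26\}$, $S_7=\{12,16,67\}$, $S_8=\{25,36,47\}$, $S_9=\{12,16,17,26\}$, $S_{10}=\{12,16,27,67\}$, $S_{11}=\{12,16,17,26,27\}$, $S_{12}=\{34,36,37,46,47,67\}$, $S_{13}=\{12,23,31,17,26,35\}$. For $J\subseteq I$ and $j\in I$: $E_J=\{jj:j\in J\}$, $F_J=\{00\}\cup\{0j:j\in J\}$, $P_{\{0,j,j\}}=\{00,0j,jj\}$. Also $Y_7=\{00,01,02,05,11,12,15\}$, $Y_{10}=\{00,01,02,05,11,12,15,22,25,55\}$, $Y_{11}=\{00\}\cup\{0i,1i:i=1,2,3,5,6\}$, $Y_{15}=\{00\}\cup\{0i,1i:i\in I\}$, $Y_{19}=Y_{15}\cup\{23,35,26,56\}$, $Y_{26}=X_0\setminus\{kl:k,l\in\{3,4,6,7\}\}$. *)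

(* Defs.v *)
From HB Require Import structures.
From mathcomp Require Import all_boot all_order all_algebra.

Set Implicit Arguments.
Unset Strict Implicit.
Unset Printing Implicit Defensive.

Import GRing.Theory.
Local Open Scope ring_scope.

Delimit Scope dec_uint_scope with uint.

(* I_0 is 'I_8 and I is the set of its nonzero elements.  The ring structure
   of 'I_8 is never used: the operation of interest is star below. *)
Definition ix (n : nat) : 'I_8 := inZp n.

Definition G : zmodType := ('Z_2 * 'Z_2 * 'Z_2)%type.

Definition gseq : seq G :=
  [:: (0, 0, 0); (1, 0, 0); (0, 1, 0); (0, 0, 1);
      (1, 1, 1); (1, 1, 0); (1, 0, 1); (0, 1, 1)].

Definition g (i : 'I_8) : G := nth 0 gseq i.

Definition star (i j : 'I_8) : 'I_8 := ix (index (g i + g j)%R gseq).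

Lemma mem_gseq (x : G) : x \in gseq.
Proof.
case: x => [[[[|[|//]] ?] [[|[|//]] ?]] [[|[|//]] ?]];
  by rewrite !inE /eq_op /=.
Qed.

Lemma g_star i j : g (star i j) = g i + g j.
Proof.
have lt8 : (index (g i + g j)%R gseq < 8)%N by rewrite index_mem mem_gseq.
by rewrite /g /star /= modn_small // nth_index // mem_gseq.
Qed.

Lemma g_inj : injective g.
Proof.
move=> i j /eqP; rewrite /g nth_uniq ?ltn_ord //.
by move/eqP/val_inj.
Qed.

Section BilinearAlgebra.

Variables (F : fieldType) (A : vectType F) (m : {bilinear A -> A -> A}).

Definition lmul (a : A) : 'End(A) := linfun (m a).
Definition rmul (a : A) : 'End(A) := linfun (applyr m a).

Lemma lmulE a b : lmul a b = m a b. Proof. by rewrite lfunE. Qed.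
Lemma rmulE a b : rmul a b = m b a. Proof. by rewrite lfunE. Qed.

Fact lmul_is_linear : linear lmul.
Proof.
by move=> k a b; apply/lfunP=> c; rewrite add_lfunE scale_lfunE !lmulE linearPl.
Qed.
HB.instance Definition _ :=
  GRing.isLinear.Build F A 'End(A) _ lmul lmul_is_linear.
Fact rmul_is_linear : linear rmul.
Proof.
by move=> k a b; apply/lfunP=> c; rewrite add_lfunE scale_lfunE !rmulE linearPr.
Qed.
HB.instance Definition _ :=
  GRing.isLinear.Build F A 'End(A) _ rmul rmul_is_linear.

Definition der_defect (x y : A) (d : 'End(A)) : A :=
  d (m x y) - (m (d x) y + m x (d y)).

Fact der_defect_is_linear x y : linear (der_defect x y).
Proof.
move=> k d e; rewrite /der_defect !lfunE /= !lfunE /=.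
rewrite linearPl linearPr scalerBr !scalerDr /=.
by rewrite [RHS]addrACA -opprD; congr (_ - _); rewrite addrACA.
Qed.
HB.instance Definition _ x y :=
  GRing.isLinear.Build F 'End(A) A _ (der_defect x y)
    (der_defect_is_linear x y).

(* The derivations; it suffices to test the Leibniz rule on a basis (see
   mem_der). *)
Definition der : {vspace 'End(A)} :=
  (\bigcap_(i < \dim {:A}) \bigcap_(j < \dim {:A})
     lker (linfun (der_defect (vbasis {:A})`_i (vbasis {:A})`_j)))%VS.

Lemma mem_der d :
  d \in der <-> forall x y, d (m x y) = m (d x) y + m x (d y).
Proof.
split=> [dD x y | dP]; last first.
  rewrite memvE; apply/subv_bigcapP => i _; apply/subv_bigcapP => j _.
  by rewrite -memvE memv_ker lfunE /= /der_defect dP subrr.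
have dP (i j : 'I_(\dim {:A})) : let x := (vbasis {:A})`_i in
    let y := (vbasis {:A})`_j in d (m x y) = m (d x) y + m x (d y).
  move: dD; rewrite memvE => /subv_bigcapP/(_ i isT)/subv_bigcapP/(_ j isT).
  by rewrite -memvE memv_ker lfunE /= subr_eq0 => /eqP.
have dPl y' (dy : forall i : 'I_(\dim {:A}), let x := (vbasis {:A})`_i in
    d (m x y') = m (d x) y' + m x (d y')) x' : d (m x' y') = m (d x') y' + m x' (d y').
  rewrite (coord_vbasis (memvf x')) !linear_sumlz (linear_sum d).
  rewrite (linear_sum d) linear_sumlz -big_split; apply: eq_bigr => i _ /=.
  by rewrite linearZl_LR !(linearZ_LR d) !linearZl_LR /= (dy i) scalerDr.
apply: dPl => i /=; rewrite (coord_vbasis (memvf y)) !linear_sumr (linear_sum d).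
rewrite (linear_sum d) linear_sumr -big_split; apply: eq_bigr => j _ /=.
by rewrite !linearZr_LR !(linearZ_LR d) linearZr_LR /= (dP i j) scalerDr.
Qed.

End BilinearAlgebra.

Section Commutator.

Variables (F : fieldType) (V : vectType F).

Definition comm (f h : 'End(V)) : 'End(V) := (f \o h)%VF - (h \o f)%VF.

Fact comm_is_bilinear : bilinear_for *:%R *:%R comm.
Proof.
split=> [h | f] k x y /=; rewrite /comm.
  rewrite comp_lfunDl comp_lfunDr -comp_lfunZl -comp_lfunZr.
  by rewrite scalerBr addrACA -opprD.
rewrite comp_lfunDl comp_lfunDr -comp_lfunZl -comp_lfunZr.
by rewrite scalerBr addrACA -opprD.
Qed.
HB.instance Definition _ :=
  bilinear_isBilinear.Build F 'End(V) 'End(V) 'End(V) *:%R *:%R comm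
    comm_is_bilinear.

End Commutator.

Section Octonions.

Variable F : fieldType.

Notation oct := 'rV[F]_8.

Definition ob (i : 'I_8) : oct := delta_mx 0 i.

Definition oct_triples : seq (nat * nat * nat) :=
  [:: (1, 2, 5); (5, 6, 7); (7, 4, 1); (1, 3, 6); (6, 4, 2); (2, 7, 3);
      (4, 5, 3)]%N.

Definition oct_cyclic (i j : nat) : bool :=
  has (fun t => (i, j) \in [:: (t.1.1, t.1.2); (t.1.2, t.2); (t.2, t.1.1)])
    oct_triples.

Definition osgn (i j : 'I_8) : F :=
  if (i == ord0) || (j == ord0) then 1
  else if i == j then -1
  else if oct_cyclic i j then 1 else -1.

Definition omul (a b : oct) : oct :=
  \sum_i \sum_j (a 0 i * b 0 j * osgn i j) *: ob (star i j).

Fact omul_is_bilinear : bilinear_for *:%R *:%R omul.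
Proof.
split=> [b | a] k x y /=; rewrite /omul scaler_sumr -big_split;
  apply: eq_bigr => i _; rewrite scaler_sumr -big_split; apply: eq_bigr => j _;
  rewrite /= !mxE scalerA -scalerDl; congr (_ *: _).
  by rewrite !mulrDl !mulrA.
by rewrite !(mulrDr, mulrDl) !mulrA [a 0 i * k]mulrC.
Qed.
HB.instance Definition _ :=
  bilinear_isBilinear.Build F oct oct oct *:%R *:%R omul omul_is_bilinear.

Lemma obE i j : ob i 0 j = (j == i)%:R. Proof. by rewrite mxE eqxx. Qed.

Lemma oct_sum_ob (a : oct) : a = \sum_i a 0 i *: ob i.
Proof. exact: row_sum_delta. Qed.

Lemma omul_ob i j : omul (ob i) (ob j) = osgn i j *: ob (star i j).
Proof.
rewrite /omul (bigD1 i) //= [X in _ + X]big1 ?addr0 => [|k kNi].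
  rewrite (bigD1 j) //= [X in _ + X]big1 ?addr0 => [|k kNj].
    by rewrite !obE !eqxx !mul1r.
  by rewrite !obE (negbTE kNj) mulr0 mul0r scale0r.
by rewrite big1 // => l _; rewrite !obE (negbTE kNi) !mul0r scale0r.
Qed.

Lemma omul_ob_sqr i : i != ord0 -> omul (ob i) (ob i) = - ob ord0.
Proof.
move=> i0; rewrite omul_ob /osgn eqxx (negbTE i0) /= scaleN1r.
congr (- ob _); apply: g_inj; rewrite g_star.
by case: i {i0} => [[|[|[|[|[|[|[|[|//]]]]]]]] ?]; apply/eqP; vm_compute.
Qed.

Lemma omul_ob_triple i j k : (i, j, k) \in oct_triples ->
  [/\ omul (ob (ix i)) (ob (ix j)) = ob (ix k),
      omul (ob (ix j)) (ob (ix k)) = ob (ix i)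
    & omul (ob (ix k)) (ob (ix i)) = ob (ix j)].
Proof.
have osgn1 x y z : [&& ix x != ord0, ix y != ord0, ix x != ix y,
    oct_cyclic (ix x) (ix y) & star (ix x) (ix y) == ix z] ->
    omul (ob (ix x)) (ob (ix y)) = ob (ix z).
  case/and5P=> x0 y0 xy c /eqP <-.
  by rewrite omul_ob /osgn (negbTE x0) (negbTE y0) (negbTE xy) c scale1r.
by rewrite !inE => /or4P[|||/or4P[|||]] /eqP[-> -> ->];
  split; apply: osgn1; vm_compute.
Qed.

Lemma omul_ob_anticomm i j : i != ord0 -> j != ord0 -> i != j ->
  omul (ob i) (ob j) = - omul (ob j) (ob i).
Proof.
move=> i0 j0 ij; rewrite !omul_ob /osgn [j == i]eq_sym (negbTE i0) (negbTE j0).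
rewrite (negbTE ij) /= -scaleNr.
have -> : star j i = star i j by apply: g_inj; rewrite !g_star addrC.
have -> : oct_cyclic j i = ~~ oct_cyclic i j.
  case: i j i0 j0 ij => [i i8] [j j8]; rewrite -!val_eqE /=.
  by move: i i8 j j8; do 8?[case=> //]; move=> _; do 8?[case=> //].
by case: oct_cyclic; rewrite ?opprK.
Qed.

Lemma omul1 a : omul (ob ord0) a = a.
Proof.
rewrite [in RHS](oct_sum_ob a) {1}(oct_sum_ob a) linear_sumr.
apply: eq_bigr => i _; rewrite linearZr_LR /= omul_ob /osgn eqxx /= scale1r.
by congr (_ *: ob _); apply: g_inj; rewrite g_star add0r.
Qed.

Definition oconj (a : oct) : oct :=
  \row_i (if i == ord0 then a 0 i else - a 0 i).

Fact oconj_is_linear : linear oconj.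
Proof.
by move=> k a b; apply/rowP=> i; rewrite !mxE; case: eqP; rewrite // opprD mulrN.
Qed.
HB.instance Definition _ :=
  GRing.isLinear.Build F oct oct _ oconj oconj_is_linear.

Definition otr (a : oct) : F^o := (a + oconj a) 0 ord0.

Lemma otrE a : a + oconj a = otr a *: ob ord0.
Proof.
apply/rowP=> i; rewrite mxE [RHS]mxE obE /otr !mxE.
by case: eqP => [->|]; rewrite ?mulr1 ?subrr ?mulr0.
Qed.

Fact otr_is_linear : linear otr.
Proof.
by move=> k a b; rewrite /otr linearP addrACA -scalerDr !mxE.
Qed.
HB.instance Definition _ := GRing.isLinear.Build F oct F^o _ otr otr_is_linear.

Definition oct0 : {vspace oct} := lker (linfun otr).

Lemma mem_oct0 a : (a \in oct0) = (otr a == 0).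
Proof. by rewrite memv_ker lfunE. Qed.

Definition ocomm (a b : oct) : oct := omul a b - omul b a.

Definition oD (a b : oct) : 'End(oct) :=
  comm (lmul omul a) (lmul omul b) + comm (lmul omul a) (rmul omul b)
  + comm (rmul omul a) (rmul omul b).

Fact ocomm_is_bilinear : bilinear_for *:%R *:%R ocomm.
Proof.
by split=> [b | a] k x y; rewrite /ocomm linearPl linearPr /= opprD addrACA
   -scalerN -scalerDr.
Qed.
HB.instance Definition _ :=
  bilinear_isBilinear.Build F oct oct oct *:%R *:%R ocomm ocomm_is_bilinear.

Fact oD_is_bilinear : bilinear_for *:%R *:%R oD.
Proof.
split=> [b | a] k x y /=; rewrite /oD (linearP (lmul _)) (linearP (rmul _)) /=.
  by rewrite !linearPl /= !scalerDr [RHS]addrACA [X in _ = X + _]addrACA.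
by rewrite !linearPr /= !scalerDr [RHS]addrACA [X in _ = X + _]addrACA.
Qed.
HB.instance Definition _ :=
  bilinear_isBilinear.Build F oct oct 'End(oct) *:%R *:%R oD oD_is_bilinear.

Definition hurwitz : seq {vspace oct} :=
  [:: <<[:: ob ord0]>>; <<[:: ob ord0; ob (ix 1)]>>;
      <<[:: ob ord0; ob (ix 1); ob (ix 2); ob (ix 5)]>>; fullv]%VS.

End Octonions.

Section MatricesOverOctonions.

Variable F : fieldType.

(* M_3(O), as finite functions because these form a vector space over F. *)
Notation mat3 := {ffun 'I_3 * 'I_3 -> 'rV[F]_8}.

Definition mmul (u v : mat3) : mat3 :=
  [ffun p => \sum_k omul (u (p.1, k)) (v (k, p.2))].

Fact mmul_is_bilinear : bilinear_for *:%R *:%R mmul.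
Proof.
split=> [v | u] k x y /=; apply/ffunP=> p; rewrite !ffunE scaler_sumr -big_split;
  apply: eq_bigr => i _; rewrite !ffunE /=.
  by rewrite linearPl.
by rewrite linearPr.
Qed.
HB.instance Definition _ :=
  bilinear_isBilinear.Build F mat3 mat3 mat3 *:%R *:%R mmul mmul_is_bilinear.

Definition mstar (u : mat3) : mat3 := [ffun p => oconj (u (p.2, p.1))].

Fact mstar_is_linear : linear mstar.
Proof. by move=> k u v; apply/ffunP=> p; rewrite !ffunE linearP. Qed.
HB.instance Definition _ :=
  GRing.isLinear.Build F mat3 mat3 _ mstar mstar_is_linear.

Definition mone : mat3 := [ffun p => if p.1 == p.2 then ob F ord0 else 0].

(* On hermitian matrices the diagonal entries are multiples of e_0. *)
Definition mtr (u : mat3) : F^o := \sum_i u (i, i) 0 ord0.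

Fact mtr_is_linear : linear mtr.
Proof.
move=> k u v; rewrite /mtr scaler_sumr -big_split.
by apply: eq_bigr => i _; rewrite !ffunE !mxE.
Qed.
HB.instance Definition _ := GRing.isLinear.Build F mat3 F^o _ mtr mtr_is_linear.

Definition mentry (p : 'I_3 * 'I_3) (u : mat3) : 'rV[F]_8 := u p.

Fact mentry_is_linear p : linear (mentry p).
Proof. by move=> k u v; rewrite /mentry !ffunE. Qed.
HB.instance Definition _ p :=
  GRing.isLinear.Build F mat3 'rV[F]_8 _ (mentry p) (mentry_is_linear p).

Variable C : {vspace 'rV[F]_8}.

Definition herm : {vspace mat3} :=
  (lker (linfun mstar - \1%VF) :&: \bigcap_p (linfun (mentry p) @^-1: C))%VS.

Lemma mem_herm u :
  u \in herm <-> mstar u = u /\ forall i j, u (i, j) \in C.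
Proof.
rewrite memv_cap memv_ker !lfunE /= opp_lfunE !lfunE /= subr_eq0.
split=> [/andP[/eqP eu uC] | [eu uC]].
  split=> // i j; move: uC; rewrite memvE => /subv_bigcapP/(_ (i, j) isT).
  by rewrite -memvE -memv_preim lfunE.
rewrite eu eqxx /= memvE; apply/subv_bigcapP => -[i j] _.
by rewrite -memvE -memv_preim lfunE; apply: uC.
Qed.

Definition J : vectType F := subvs_of herm.

(* vsproj is the identity here (see jmulE and joneE): for C a Hurwitz algebra,
   the matrices it is applied to do belong to herm. *)
Definition jmul (u v : J) : J :=
  vsproj herm (2%:R^-1 *: (mmul (vsval u) (vsval v) + mmul (vsval v) (vsval u))).

Definition jone : J := vsproj herm mone.

Fact jmul_is_bilinear : bilinear_for *:%R *:%R jmul.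
Proof.
split=> [v | u] k x y /=; rewrite /jmul -linearP; congr (vsproj _ _);
  rewrite (linearP vsval) linearPl linearPr addrACA scalerDr; congr (_ + _);
  by rewrite -scalerDr !scalerA mulrC.
Qed.
HB.instance Definition _ :=
  bilinear_isBilinear.Build F J J J *:%R *:%R jmul jmul_is_bilinear.

Definition jtr (u : J) : F^o := mtr (vsval u).

Fact jtr_is_linear : linear jtr.
Proof. by move=> k u v; rewrite /jtr !linearP. Qed.
HB.instance Definition _ := GRing.isLinear.Build F J F^o _ jtr jtr_is_linear.

Definition J0 : {vspace J} := lker (linfun jtr).

Lemma mem_J0 u : (u \in J0) = (jtr u == 0).
Proof. by rewrite memv_ker lfunE. Qed.

Definition jstar (u v : J) : J :=
  jmul u v - (3%:R^-1 * jtr (jmul u v)) *: jone.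

Fact jstar_is_bilinear : bilinear_for *:%R *:%R jstar.
Proof.
split=> [b | a] k x y /=; rewrite /jstar ?(linearPl, linearPr) linearP /=;
  rewrite scalerBr addrACA -opprD; congr (_ - _);
  by rewrite mulrDr scalerDl scalerA mulrCA.
Qed.
HB.instance Definition _ :=
  bilinear_isBilinear.Build F J J J *:%R *:%R jstar jstar_is_bilinear.

End MatricesOverOctonions.

Section HurwitzClosure.

Variable F : fieldType.

Local Notation ob := (ob F).

Lemma starC i j : star i j = star j i.
Proof. by apply: g_inj; rewrite !g_star addrC. Qed.

Lemma star0 i : star i ord0 = i.
Proof. by apply: g_inj; rewrite g_star addr0. Qed.

Lemma starIr j : injective (star^~ j).
Proof.
move=> i i' /= e; apply: g_inj; apply: (@addIr G (g j) (g i) (g i')).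
by rewrite -(g_star i) e (g_star i').
Qed.

Lemma star_eq0 i j : (star i j == ord0) = (i == j).
Proof.
have opp (x : G) : - x = x.
  by case: x => [[[[|[|//]] ?] [[|[|//]] ?]] [[|[|//]] ?]]; apply/eqP.
apply/eqP/eqP => [/(congr1 g) | ->]; last first.
  by apply: g_inj; rewrite g_star -[X in _ + X]opp subrr.
by rewrite g_star -[X in _ + X]opp => /subr0_eq/g_inj.
Qed.

Lemma oconj_ob i : oconj (ob i) = if i == ord0 then ob i else - ob i.
Proof.
apply/rowP=> j; rewrite mxE !obE; case: (j =P i) => [->|ji].
  by case: ifP => _; rewrite ?mxE ?obE ?eqxx.
by rewrite oppr0; do 2!case: ifP => _; rewrite ?mxE ?eqxx /= ?(introF eqP ji) ?oppr0.
Qed.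

Lemma omulr1 (a : 'rV[F]_8) : omul a (ob ord0) = a.
Proof.
rewrite [in RHS](oct_sum_ob a) {1}(oct_sum_ob a) linear_sumlz.
apply: eq_bigr => i _.
by rewrite linearZl_LR /= omul_ob /osgn eqxx orbT /= scale1r star0.
Qed.

Lemma oconjM (a b : 'rV[F]_8) : oconj (omul a b) = omul (oconj b) (oconj a).
Proof.
have red (x y : 'rV[F]_8) : (forall i j, oconj (omul (ob i) (ob j))
    = omul (oconj (ob j)) (oconj (ob i))) ->
    oconj (omul x y) = omul (oconj y) (oconj x).
  move=> obM; rewrite (oct_sum_ob x) linear_sumlz !(linear_sum (@oconj F)).
  rewrite linear_sumr; apply: eq_bigr => i _ /=.
  rewrite (oct_sum_ob y) linear_sumr !(linear_sum (@oconj F)) linear_sumlz.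
  apply: eq_bigr => j _ /=.
  rewrite linearZl_LR linearZr_LR /= !(linearZ_LR (@oconj F)) /=.
  by rewrite linearZl_LR linearZr_LR /= !scalerA mulrC obM.
apply: red => i j.
rewrite omul_ob linearZ /= !oconj_ob star_eq0.
case: (eqVneq i ord0) => [->|i0].
  rewrite omulr1 /osgn eqxx scale1r starC star0 eq_sym /=.
  by case: (eqVneq j ord0).
case: (eqVneq j ord0) => [->|j0].
  by rewrite omul1 /osgn eqxx orbT scale1r star0 (negbTE i0).
rewrite linearNl linearNr opprK /=; case: (eqVneq i j) => [->|ij].
  by rewrite -omul_ob.
by rewrite scalerN -omul_ob [in LHS]omul_ob_anticomm // opprK.
Qed.

Lemma span_ob_mul (s : seq 'I_8) (a b : 'rV[F]_8) :
    {in s &, forall i j, star i j \in s} ->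
  a \in <<map ob s>>%VS -> b \in <<map ob s>>%VS -> omul a b \in <<map ob s>>%VS.
Proof.
move=> sM /(coord_span (X := in_tuple _)) -> /(coord_span (X := in_tuple _)) ->.
rewrite linear_sumlz memv_suml // => i _; rewrite linear_sumr memv_suml // => j _.
rewrite linearZl_LR linearZr_LR /= !memvZ //.
have lti : (i < size s)%N by rewrite -(size_map ob).
have ltj : (j < size s)%N by rewrite -(size_map ob).
rewrite !(nth_map ord0) // omul_ob memvZ // memv_span // map_f //.
by apply: sM; apply: mem_nth.
Qed.

Lemma hurwitzM (C : {vspace 'rV[F]_8}) a b :
  C \in hurwitz F -> a \in C -> b \in C -> omul a b \in C.
Proof.
rewrite !inE => /or4P[] /eqP->; last by rewrite !memvf.
- by apply: (@span_ob_mul [:: ord0]) => i j; rewrite !inE => /eqP-> /eqP->.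
- apply: (@span_ob_mul [:: ord0; ix 1]) => i j.
  by rewrite !inE => /orP[] /eqP-> /orP[] /eqP->.
apply: (@span_ob_mul [:: ord0; ix 1; ix 2; ix 5]) => i j.
by rewrite !inE => /or4P[] /eqP-> /or4P[] /eqP->.
Qed.

Lemma hurwitz1 (C : {vspace 'rV[F]_8}) : C \in hurwitz F -> ob ord0 \in C.
Proof.
by rewrite !inE => /or4P[] /eqP->; rewrite ?memvf // memv_span // inE eqxx.
Qed.

Lemma mmul_star (u v : {ffun 'I_3 * 'I_3 -> 'rV[F]_8}) :
  mstar (mmul u v) = mmul (mstar v) (mstar u).
Proof.
apply/ffunP=> p; rewrite !ffunE linear_sum; apply: eq_bigr => k _.
by rewrite !ffunE /= oconjM.
Qed.

Lemma jmulE (C : {vspace 'rV[F]_8}) (u v : J C) : C \in hurwitz F ->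
  vsval (jmul u v)
  = 2%:R^-1 *: (mmul (vsval u) (vsval v) + mmul (vsval v) (vsval u)).
Proof.
move=> hC; rewrite vsprojK // memvZ //.
have /mem_herm[eu uC] := subvsP u; have /mem_herm[ev vC] := subvsP v.
apply/mem_herm; split; first by rewrite linearD /= !mmul_star eu ev addrC.
move=> i j; rewrite !ffunE memvD // memv_suml // => k _; exact: hurwitzM.
Qed.

Lemma joneE (C : {vspace 'rV[F]_8}) : C \in hurwitz F ->
  vsval (jone C) = mone F.
Proof.
move=> hC; rewrite vsprojK //; apply/mem_herm; split.
  apply/ffunP=> -[i j]; rewrite !ffunE /= eq_sym; case: eqP => _.
    by rewrite oconj_ob.
  by rewrite linear0.
by move=> i j; rewrite !ffunE /=; case: eqP; rewrite ?mem0v ?hurwitz1.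
Qed.

(* The trace of a matrix of J is an element of F e_0, identified with F. *)
Lemma jtrE (C : {vspace 'rV[F]_8}) (u : J C) : 2%:R != 0 :> F ->
  \sum_i vsval u (i, i) = jtr u *: ob ord0.
Proof.
move=> F2; rewrite scaler_suml; apply: eq_bigr => i _.
have /mem_herm[/ffunP/(_ (i, i)) eu _] := subvsP u; apply/rowP=> j.
rewrite [RHS]mxE obE; case: (eqVneq j ord0) => [->|j0]; rewrite ?mulr1 // mulr0.
move/rowP/(_ j): eu; rewrite !ffunE mxE (negbTE j0) => /eqP.
by rewrite eq_sym -subr_eq0 opprK -mulr2n -mulr_natl mulf_eq0 (negbTE F2) => /eqP.
Qed.

End HurwitzClosure.

Section TensorProduct.

Variables (F : fieldType) (V : vectType F).

(* O (x) V in coordinates: w : {ffun 'I_8 -> V} stands for the sum of the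
   e_i (x) w_i. *)
Definition tens (a : 'rV[F]_8) (u : V) : {ffun 'I_8 -> V} :=
  [ffun i => a 0 i *: u].

Fact tens_is_bilinear : bilinear_for *:%R *:%R tens.
Proof.
split=> [u | a] k x y; apply/ffunP=> i; rewrite !ffunE /=.
  by rewrite !mxE scalerDl scalerA.
by rewrite scalerDr !scalerA mulrC.
Qed.
HB.instance Definition _ :=
  bilinear_isBilinear.Build F 'rV[F]_8 V {ffun 'I_8 -> V} *:%R *:%R tens
    tens_is_bilinear.
HB.instance Definition _ (a : 'rV[F]_8) :=
  GRing.isLinear.Build F V {ffun 'I_8 -> V} _ (tens a) (tens_is_bilinear.2 a).

Lemma tens_sum (w : {ffun 'I_8 -> V}) : w = \sum_i tens (ob F i) (w i).
Proof.
apply/ffunP=> j; rewrite sum_ffunE (bigD1 j) //= ffunE obE eqxx scale1r.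
by rewrite big1 ?addr0 // => i /negbTE ij; rewrite ffunE obE eq_sym ij scale0r.
Qed.

Definition tensv (A : {vspace 'rV[F]_8}) (U : {vspace V}) :
    {vspace {ffun 'I_8 -> V}} :=
  (\sum_(i < \dim A) linfun (tens (vbasis A)`_i) @: U)%VS.

Lemma mem_tensv (A : {vspace 'rV[F]_8}) (U : {vspace V}) a u :
  a \in A -> u \in U -> tens a u \in tensv A U.
Proof.
move=> aA uU; rewrite (coord_vbasis aA) linear_sumlz memv_suml // => i _.
rewrite linearZl_LR memvZ //; apply: (subvP (sumv_sup i isT (subvv _))).
by have := memv_img (linfun (tens (vbasis A)`_i)) uU; rewrite lfunE.
Qed.

Lemma tensv_min (A : {vspace 'rV[F]_8}) (U : {vspace V})
    (W : {vspace {ffun 'I_8 -> V}}) :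
    (forall a u, a \in A -> u \in U -> tens a u \in W) ->
  (tensv A U <= W)%VS.
Proof.
move=> AUW; apply/subv_sumP => i _; apply/subvP => _ /memv_imgP[u uU ->].
by rewrite lfunE; apply: AUW => //; rewrite vbasis_mem // mem_nth // size_tuple.
Qed.

(* d (x) 1 and 1 (x) D *)
Definition tensl (d : 'End('rV[F]_8)) (w : {ffun 'I_8 -> V}) :
    {ffun 'I_8 -> V} := \sum_i tens (d (ob F i)) (w i).
Definition tensr (D : 'End(V)) (w : {ffun 'I_8 -> V}) : {ffun 'I_8 -> V} :=
  [ffun i => D (w i)].

Lemma tenslE d a u : tensl d (tens a u) = tens (d a) u.
Proof.
rewrite [in RHS](oct_sum_ob a) linear_sum linear_sumlz; apply: eq_bigr => i _.
by rewrite ffunE (linearZ_LR d) linearZl_LR linearZr_LR.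
Qed.

Lemma tensrE D a u : tensr D (tens a u) = tens a (D u).
Proof. by apply/ffunP=> i; rewrite !ffunE linearZ. Qed.

Lemma tensl0 d : tensl d 0 = 0.
Proof. by rewrite /tensl big1 // => i _; rewrite ffunE linear0r. Qed.
Lemma tens0l w : tensl 0 w = 0.
Proof. by rewrite /tensl big1 // => i _; rewrite lfunE /= linear0l. Qed.
Lemma tensr0 D : tensr D 0 = 0.
Proof. by apply/ffunP=> i; rewrite !ffunE linear0. Qed.
Lemma tens0r w : tensr 0 w = 0.
Proof. by apply/ffunP=> i; rewrite !ffunE lfunE. Qed.

End TensorProduct.

Section LieAlgebra.

Variables (F : fieldType) (C : {vspace 'rV[F]_8}).

Local Notation oct := 'rV[F]_8.
Local Notation J := (J C).
Local Notation ob := (ob F).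
Local Notation R := (rmul (@jmul F C)).

(* End(O) (+) (O (x) J) (+) End(J), inside which L = T(C) is the subspace
   TC below.  The bracket br is given by the formulas defining the bracket of
   L, extended bilinearly to this ambient space: see br_der to br_tens_tens. *)
Definition amb : vectType F :=
  ('End(oct) * {ffun 'I_8 -> J} * 'End(J))%type.

Definition inO_fun (d : 'End(oct)) : amb := (d, 0, 0).
Definition inT_fun (w : {ffun 'I_8 -> J}) : amb := (0, w, 0).
Definition inJ_fun (D : 'End(J)) : amb := (0, 0, D).

Fact inO_fun_is_linear : linear inO_fun.
Proof.
move=> k x y; apply: injective_projections; first apply: injective_projections;
  by rewrite /= ?scaler0 ?addr0.
Qed.
HB.instance Definition _ :=
  GRing.isLinear.Build F 'End(oct) amb _ inO_fun inO_fun_is_linear.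

Definition inO : 'Hom('End(oct), amb) := linfun inO_fun.

Lemma inOE d : inO d = (d, 0, 0). Proof. exact: lfunE. Qed.

Fact inT_fun_is_linear : linear inT_fun.
Proof.
move=> k x y; apply: injective_projections; first apply: injective_projections;
  by rewrite /= ?scaler0 ?addr0.
Qed.
HB.instance Definition _ :=
  GRing.isLinear.Build F {ffun 'I_8 -> J} amb _ inT_fun inT_fun_is_linear.

Definition inT : 'Hom({ffun 'I_8 -> J}, amb) := linfun inT_fun.

Lemma inTE w : inT w = (0, w, 0). Proof. exact: lfunE. Qed.

Fact inJ_fun_is_linear : linear inJ_fun.
Proof.
move=> k x y; apply: injective_projections; first apply: injective_projections;
  by rewrite /= ?scaler0 ?addr0.
Qed.
HB.instance Definition _ :=
  GRing.isLinear.Build F 'End(J) amb _ inJ_fun inJ_fun_is_linear.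

Definition inJ : 'Hom('End(J), amb) := linfun inJ_fun.

Lemma inJE D : inJ D = (0, 0, D). Proof. exact: lfunE. Qed.

Let inXE := (inOE, inTE, inJE).

Definition derO : {vspace 'End(oct)} := der (@omul F).
Definition derJ : {vspace 'End(J)} := der (@jmul F C).

Definition TC : {vspace amb} :=
  (inO @: derO + inT @: tensv (oct0 F) (J0 C)
   + inJ @: derJ)%VS.

Definition br (x y : amb) : amb :=
  let: (d, w, D) := x in
  let: (d', w', D') := y in
  ( comm d d'
    + \sum_i \sum_j
        (3%:R^-1 * jtr (jmul (w i) (w' j))) *: oD (ob i) (ob j),
    tensl d w' - tensl d' w + tensr D w' - tensr D' w
    + \sum_i \sum_j tens (ocomm (ob i) (ob j)) (jstar (w i) (w' j)),
    comm D D'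
    + \sum_i \sum_j
        (2%:R * otr (omul (ob i) (ob j))) *: comm (R (w i)) (R (w' j)) ).

Let brE x y : br x y =
  ( comm x.1.1 y.1.1
    + \sum_i \sum_j (3%:R^-1 * jtr (jmul (x.1.2 i) (y.1.2 j)))
        *: oD (ob i) (ob j),
    tensl x.1.1 y.1.2 - tensl y.1.1 x.1.2 + tensr x.2 y.1.2 - tensr y.2 x.1.2
    + \sum_i \sum_j tens (ocomm (ob i) (ob j)) (jstar (x.1.2 i) (y.1.2 j)),
    comm x.2 y.2
    + \sum_i \sum_j (2%:R * otr (omul (ob i) (ob j)))
        *: comm (R (x.1.2 i)) (R (y.1.2 j)) ).
Proof. by case: x y => [[d w] D] [[d' w'] D']. Qed.

Let sum20 (U : nmodType) (f : 'I_8 -> 'I_8 -> U) :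
  (forall i j, f i j = 0) -> \sum_i \sum_j f i j = 0.
Proof. by move=> f0; rewrite big1 // => i _; rewrite big1. Qed.

Lemma br0l x : br 0 x = 0.
Proof.
rewrite brE /= tens0l tensl0 tens0r tensr0 !linear0l !subr0 !add0r.
by rewrite !sum20 // => i j;
  rewrite ffunE ?linear0 linear0l ?linear0 ?linear0r ?mulr0 ?scale0r ?scaler0.
Qed.

Lemma br0r x : br x 0 = 0.
Proof.
rewrite brE /= tens0l tensl0 tens0r tensr0 !linear0r !subr0 !add0r.
by rewrite !sum20 // => i j;
  rewrite ffunE ?linear0 linear0r ?linear0 ?linear0r ?mulr0 ?scale0r ?scaler0.
Qed.

Lemma br_der d d' : br (inO d) (inO d') = inO (comm d d').
Proof.
rewrite !inXE brE /= !tensl0 !tensr0 linear0l !subr0 !add0r !sum20 ?addr0 // => i j;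
  by rewrite !ffunE ?linear0 linear0l ?linear0 ?linear0r ?mulr0 ?scale0r ?scaler0.
Qed.

Lemma br_derJ D D' : br (inJ D) (inJ D') = inJ (comm D D').
Proof.
rewrite !inXE brE /= !tensl0 !tensr0 linear0l !subr0 !add0r !sum20 ?addr0 // => i j;
  by rewrite !ffunE ?linear0 linear0l ?linear0 ?linear0r ?mulr0 ?scale0r ?scaler0.
Qed.

Lemma br_der_derJ d D : br (inO d) (inJ D) = 0.
Proof.
rewrite !inXE brE /= !tensl0 !tensr0 linear0l linear0r !subr0 !add0r !sum20 // => i j;
  by rewrite !ffunE ?linear0 linear0l ?linear0 ?linear0r ?mulr0 ?scale0r ?scaler0.
Qed.

Lemma br_der_tens d a u : br (inO d) (inT (tens a u)) = inT (tens (d a) u).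
Proof.
rewrite !inXE brE /= !tenslE !tensl0 tens0r !tensr0 !linear0r !subr0 !add0r addr0.
rewrite !sum20 ?addr0 // => i j;
  by rewrite !ffunE ?linear0 linear0l ?linear0 ?linear0r ?mulr0 ?scale0r ?scaler0.
Qed.

Lemma br_derJ_tens D a u : br (inJ D) (inT (tens a u)) = inT (tens a (D u)).
Proof.
rewrite !inXE brE /= tensrE tens0l tensl0 !tensr0 linear0l linear0r !subr0 !add0r.
rewrite !sum20 ?addr0 // => i j;
  by rewrite !ffunE ?linear0 linear0l ?linear0 ?linear0r ?mulr0 ?scale0r ?scaler0.
Qed.

Let sum_ob2 (U : lmodType F) (f : {bilinear oct -> oct -> U}) a b :
  f a b = \sum_i \sum_j (a 0 i * b 0 j) *: f (ob i) (ob j).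
Proof.
rewrite {1}(oct_sum_ob a) linear_sumlz; apply: eq_bigr => i _.
rewrite linearZl_LR {1}(oct_sum_ob b) linear_sumr /= scaler_sumr.
by apply: eq_bigr => j _; rewrite linearZr_LR /= scalerA.
Qed.

Lemma br_tens_tens a b u v :
  br (inT (tens a u)) (inT (tens b v))
  = inO ((3%:R^-1 * jtr (jmul u v)) *: oD a b)
    + inT (tens (ocomm a b) (jstar u v))
    + inJ ((2%:R * otr (omul a b)) *: comm (R u) (R v)).
Proof.
have -> o w D : inO o + inT w + inJ D = (o, w, D).
  rewrite !inXE; apply: injective_projections; first apply: injective_projections;
    by rewrite /= ?addr0 ?add0r.
rewrite !inTE brE /= !tens0l !tens0r !linear0l !subr0 !add0r.
congr (_, _, _).
- rewrite (sum_ob2 (@oD F)) scaler_sumr; apply: eq_bigr => i _.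
  rewrite scaler_sumr; apply: eq_bigr => j _; rewrite !ffunE.
  rewrite linearZl_LR linearZr_LR /= scalerA linearZ scalerA /=.
  by congr (_ *: _); rewrite mulrCA [LHS]mulrC.
- rewrite (sum_ob2 (@ocomm F)) linear_sumlz; apply: eq_bigr => i _.
  rewrite linear_sumlz; apply: eq_bigr => j _; rewrite !ffunE.
  have -> : jstar (a 0 i *: u) (b 0 j *: v) = (a 0 i * b 0 j) *: jstar u v.
    by rewrite linearZl_LR linearZr_LR /= scalerA.
  by rewrite linearZl_LR linearZr_LR.
rewrite (sum_ob2 (@omul F)) linear_sum mulr_sumr scaler_suml.
apply: eq_bigr => i _; rewrite linear_sum mulr_sumr scaler_suml.
apply: eq_bigr => j _; rewrite !ffunE.
rewrite [in RHS]linearZ /= !(linearZ_LR R) linearZl_LR linearZr_LR /= !scalerA.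
by congr (_ *: _); rewrite -[(_ * _) *: _]/(_ * _ * _) [RHS]mulrCA [RHS]mulrC !mulrA.
Qed.

Definition evalob (j : 'I_8) (d : 'End(oct)) : oct := d (ob j).

Fact evalob_is_linear j : linear (evalob j).
Proof. by move=> k d d'; rewrite /evalob add_lfunE scale_lfunE. Qed.
HB.instance Definition _ j :=
  GRing.isLinear.Build F 'End(oct) oct _ (evalob j) (evalob_is_linear j).

Definition Dcomp (i : 'I_8) : {vspace 'End(oct)} :=
  (derO :&: \bigcap_j linfun (evalob j) @^-1: <[ob (star i j)]>)%VS.

Lemma mem_Dcomp i d :
  d \in Dcomp i <-> d \in derO /\ forall j, d (ob j) \in <[ob (star i j)]>%VS.
Proof.
rewrite memv_cap; split=> [/andP[dO dD] | [-> dD]]; last first.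
  rewrite memvE; apply/subv_bigcapP => j _.
  by rewrite -memvE -memv_preim lfunE; apply: dD.
split=> // j; move: dD; rewrite memvE => /subv_bigcapP/(_ j isT).
by rewrite -memvE -memv_preim lfunE.
Qed.

Definition Mcomp (i : 'I_8) : {vspace {ffun 'I_8 -> J}} :=
  (linfun (tens (ob i)) @: J0 C)%VS.

Definition Lcomp (i : 'I_8) : {vspace amb} :=
  (if i == ord0 then inJ @: derJ
   else inO @: Dcomp i + inT @: Mcomp i)%VS.

(* hcomp k is the projection onto the degree g_k part for the G-grading of the
   ambient space that induces the decomposition of L into the Lcomp k; see
   hcomp_id and hcomp_eq0. *)
Definition oend_comp_fun (k : 'I_8) (d : 'End(oct)) (a : oct) : oct :=
  \sum_j (a 0 j * d (ob j) 0 (star k j)) *: ob (star k j).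

Fact oend_comp_fun_is_linear k d : linear (oend_comp_fun k d).
Proof.
move=> c a b; rewrite /oend_comp_fun scaler_sumr -big_split.
by apply: eq_bigr => j _; rewrite !mxE mulrDl scalerDl -mulrA -scalerA.
Qed.
HB.instance Definition _ k d :=
  GRing.isLinear.Build F oct oct _ (oend_comp_fun k d)
    (oend_comp_fun_is_linear k d).

Definition oend_comp (k : 'I_8) (d : 'End(oct)) : 'End(oct) :=
  linfun (oend_comp_fun k d).

Definition hcomp (k : 'I_8) (x : amb) : amb :=
  let: (d, w, D) := x in
  (oend_comp k d, tens (ob k) (w k), if k == ord0 then D else 0).

Lemma oend_comp0 k : oend_comp k 0 = 0.
Proof.
apply/lfunP=> a; rewrite !lfunE /= /oend_comp_fun big1 // => j _.
by rewrite lfunE mxE mulr0 scale0r.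
Qed.

Lemma Dcomp_ob k d j : d \in Dcomp k ->
  d (ob j) = d (ob j) 0 (star k j) *: ob (star k j).
Proof.
case/mem_Dcomp => _ /(_ j)/vlineP[c ->].
by rewrite mxE obE eqxx mulr1.
Qed.

Lemma oend_comp_id k d : d \in Dcomp k -> oend_comp k d = d.
Proof.
move=> dk; apply/lfunP=> a; rewrite lfunE /= [in RHS](oct_sum_ob a) linear_sum.
by apply: eq_bigr => j _; rewrite linearZ /= (Dcomp_ob j dk) scalerA mxE obE
  eqxx mulr1.
Qed.

Lemma oend_comp_eq0 k l d : d \in Dcomp l -> k != l -> oend_comp k d = 0.
Proof.
move=> dl kl; apply/lfunP=> a; rewrite !lfunE /= /oend_comp_fun big1 // => j _.
rewrite (Dcomp_ob j dl) mxE obE; case: eqP => [/starIr/eqP|_].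
  by rewrite (negbTE kl).
by rewrite !mulr0 scale0r.
Qed.

Lemma Lcomp_ind (P : 'I_8 -> amb -> Prop) :
    (forall D, D \in derJ -> P ord0 (inJ D)) ->
    (forall i d u, i != ord0 -> d \in Dcomp i -> u \in J0 C ->
       P i (d, tens (ob i) u, 0)) ->
  forall i x, x \in Lcomp i -> P i x.
Proof.
move=> PJ PI i x; rewrite /Lcomp; case: (eqVneq i ord0) => [->|i0].
  by move=> /memv_imgP[D DJ ->]; apply: PJ.
move=> /memv_addP[_ /memv_imgP[d dD ->] [_ /memv_imgP[w]]] + -> ->.
move=> /memv_imgP[u uJ ->]; rewrite (lfunE (tens (ob i))).
suff -> : inO d + inT (tens (ob i) u) = (d, tens (ob i) u, 0) by apply: PI.
rewrite !inXE; apply: injective_projections; first apply: injective_projections;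
  by rewrite /= ?addr0 ?add0r.
Qed.

Lemma hcomp_id k x : x \in Lcomp k -> hcomp k x = x.
Proof.
elim/Lcomp_ind: k x / => [D _|k d u k0 dD _]; rewrite ?inJE /=.
  by rewrite oend_comp0 ffunE linear0r.
by rewrite oend_comp_id // ffunE obE eqxx scale1r (negbTE k0).
Qed.

Lemma hcomp_eq0 k l x : x \in Lcomp l -> k != l -> hcomp k x = 0.
Proof.
move=> xl; elim/Lcomp_ind: l x / xl k => [D _ k|l d u l0 dD _ k] kl; rewrite ?inJE /=.
  by rewrite oend_comp0 ffunE linear0r (negbTE kl).
rewrite (oend_comp_eq0 dD) // ffunE obE (negbTE kl) scale0r linear0r.
by rewrite if_same.
Qed.

End LieAlgebra.

(* Unordered pairs {i, j} of elements of I_0, with i = j allowed, are the sets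
   [set i; j]. *)
Definition X0 : {set {set 'I_8}} := [set [set p.1; p.2] | p : 'I_8 * 'I_8].

Definition P_ (i j k : 'I_8) : {set {set 'I_8}} :=
  [set [set i; j]; [set j; k]; [set k; i];
       [set i; star j k]; [set j; star k i]; [set k; star i j]].

Definition generalised_nice (T : {set {set 'I_8}}) : bool :=
  (T \subset X0) &&
  [forall i, forall j, forall k,
     ([set i; j] \in T) && ([set star i j; k] \in T) ==> (P_ i j k \subset T)].

Section GradedContractions.

Variables (F : fieldType) (C : {vspace 'rV[F]_8}).

Definition eps (T : {set {set 'I_8}}) (i j : 'I_8) : F :=
  ([set i; j] \in T)%:R.

(* The bracket of L_T: on homogeneous elements it is given by brTE. *)
Definition brT (T : {set {set 'I_8}}) (x y : amb C) : amb C :=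
  \sum_i \sum_j eps T i j *: br (hcomp i x) (hcomp j y).

Lemma brTE T i j x y : x \in Lcomp C i -> y \in Lcomp C j ->
  brT T x y = eps T i j *: br x y.
Proof.
move=> xi yj; rewrite /brT (bigD1 i) //= [X in _ + X]big1 ?addr0 => [|k kNi].
  rewrite (bigD1 j) //= [X in _ + X]big1 ?addr0 => [|k kNj].
    by rewrite !hcomp_id.
  by rewrite (hcomp_eq0 yj kNj) br0r scaler0.
by rewrite big1 // => l _; rewrite (hcomp_eq0 xi kNi) br0l scaler0.
Qed.

(* A linear map L_T -> L_T' is given as the restriction to L of a linear map of
   the ambient space. *)
Definition graded_iso (T T' : {set {set 'I_8}}) : Prop :=
  exists f : 'End(amb C),
    [/\ {in TC C &, injective f}, (f @: TC C)%VS = TC C,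
        {in TC C &, forall x y, f (brT T x y) = brT T' (f x) (f y)}
      & forall i, exists k, (f @: Lcomp C i)%VS = Lcomp C k].

End GradedContractions.

(* A string of digits denotes the set of its digits; in particular the string
   ij denotes the pair {i, j}. *)
Fixpoint dec_digits (d : Decimal.uint) : seq nat :=
  match d with
  | Decimal.Nil => [::]
  | Decimal.D0 d => 0 :: dec_digits d
  | Decimal.D1 d => 1 :: dec_digits d
  | Decimal.D2 d => 2 :: dec_digits d
  | Decimal.D3 d => 3 :: dec_digits d
  | Decimal.D4 d => 4 :: dec_digits d
  | Decimal.D5 d => 5 :: dec_digits d
  | Decimal.D6 d => 6 :: dec_digits d
  | Decimal.D7 d => 7 :: dec_digits d
  | Decimal.D8 d => 8 :: dec_digits d
  | Decimal.D9 d => 9 :: dec_digits d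
  end%N.

Definition digits (d : Number.uint) : seq nat :=
  if d is Number.UIntDecimal d' then dec_digits d' else [::].

Definition dset (d : Number.uint) : {set 'I_8} := [set:: map ix (digits d)].

Definition pairs (s : seq Number.uint) : {set {set 'I_8}} :=
  [set:: map dset s].

Definition S_ (i : nat) : {set {set 'I_8}} :=
  match i with
  | 1 => pairs [:: 12]%uint
  | 2 => pairs [:: 12; 13]%uint
  | 3 => pairs [:: 12; 67]%uint
  | 4 => pairs [:: 12; 13; 14]%uint
  | 6 => pairs [:: 12; 16; 26]%uint
  | 7 => pairs [:: 12; 16; 67]%uint
  | 8 => pairs [:: 25; 36; 47]%uint
  | 9 => pairs [:: 12; 16; 17; 26]%uint
  | 10 => pairs [:: 12; 16; 27; 67]%uint
  | 11 => pairs [:: 12; 16; 17; 26; 27]%uint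
  | 12 => pairs [:: 34; 36; 37; 46; 47; 67]%uint
  | 13 => pairs [:: 12; 23; 31; 17; 26; 35]%uint
  | _ => set0
  end.

Definition E_ (J : {set 'I_8}) : {set {set 'I_8}} := [set [set j; j] | j in J].

Definition F_ (J : {set 'I_8}) : {set {set 'I_8}} :=
  [set ord0; ord0] |: [set [set ord0; j] | j in J].

Definition P0_ (j : nat) : {set {set 'I_8}} := P_ ord0 (ix j) (ix j).

Definition Y7 := pairs [:: 00; 01; 02; 05; 11; 12; 15]%uint.
Definition Y10 := pairs [:: 00; 01; 02; 05; 11; 12; 15; 22; 25; 55]%uint.
Definition Y11 : {set {set 'I_8}} :=
  pairs [:: 00]%uint :|: [set [set ord0; i] | i in dset 12356%uint]
  :|: [set [set ix 1; i] | i in dset 12356%uint].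
Definition Y15 : {set {set 'I_8}} :=
  pairs [:: 00]%uint :|: [set [set ord0; i] | i in dset 1234567%uint]
  :|: [set [set ix 1; i] | i in dset 1234567%uint].
Definition Y19 : {set {set 'I_8}} := Y15 :|: pairs [:: 23; 35; 26; 56]%uint.
Definition Y26 : {set {set 'I_8}} :=
  X0 :\: [set [set k; l] | k in dset 3467%uint, l in dset 3467%uint].

(* S_i \cup E_J and S_i \cup F_J, for J in a list of strings. *)
Definition SE (i : nat) (s : seq Number.uint) : seq {set {set 'I_8}} :=
  [seq S_ i :|: E_ (dset J) | J <- s].
Definition SF (i : nat) (s : seq Number.uint) : seq {set {set 'I_8}} :=
  [seq S_ i :|: F_ (dset J) | J <- s].

Notation "∅" := (Number.UIntDecimal Decimal.Nil) : dec_uint_scope.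

Definition list1 : seq {set {set 'I_8}} := [:: Y7; Y10; Y11; Y15; Y19; Y26; X0].

Definition list2 : seq {set {set 'I_8}} :=
  [:: P0_ 1; S_ 1 :|: P0_ 3; S_ 2 :|: P0_ 4; S_ 3 :|: P0_ 3; S_ 6 :|: P0_ 7;
      S_ 7 :|: P0_ 4; S_ 10 :|: P0_ 4].

Definition list3 : seq {set {set 'I_8}} :=
  let s := [:: ∅; 1; 12; 123; 1234; 12345; 123456; 1234567]%uint in
  [seq E_ (dset J) | J <- s] ++ [seq F_ (dset J) | J <- s].

Definition list4 : seq {set {set 'I_8}} :=
  SE 1 [:: ∅; 1; 3; 12; 13; 34; 123; 134; 346; 1234; 3467; 1367; 12346; 13467;
           123467]%uint
  ++ SE 2 [:: ∅; 1; 2; 4; 12; 14; 23; 24; 47; 123; 124; 234; 247; 147; 1234;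
              1247; 2347; 12347]%uint
  ++ SE 3 [:: ∅; 1; 3; 12; 13; 16; 34; 123; 126; 134; 136; 1234; 1267; 1236;
              1346; 12346; 12367; 123467]%uint
  ++ SE 4 [:: ∅; 1; 2; 12; 23; 123; 234; 1234]%uint
  ++ SE 6 [:: ∅; 1; 7; 12; 17; 126; 127; 1267]%uint
  ++ SE 7 [:: ∅; 1; 2; 4; 12; 14; 16; 17; 24; 27; 124; 126; 127; 146; 247; 147;
              1267; 1246; 1247; 12467]%uint
  ++ SE 8 [:: ∅; 2; 23; 25; 234; 235; 2356; 2345; 23456; 234567]%uint
  ++ SE 9 [:: ∅; 1; 2; 7; 12; 17; 26; 27; 126; 127; 267; 1267]%uint
  ++ SE 10 [:: ∅; 1; 4; 12; 14; 17; 124; 126; 147; 1267; 1246; 12467]%uint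
  ++ SE 11 [:: ∅; 1; 6; 12; 16; 67; 126; 167; 1267]%uint
  ++ SE 12 [:: ∅; 3; 34; 346; 3467]%uint
  ++ SE 13 [:: ∅; 1; 12; 123]%uint.

Definition list5 : seq {set {set 'I_8}} :=
  SF 1 [:: ∅; 3; 34; 125; 347; 3467; 1235; 12567; 123456; 1234567]%uint
  ++ SF 2 [:: ∅; 4; 47; 12356; 123456; 1234567]%uint
  ++ SF 3 [:: ∅; 3; 34; 12567; 123567; 1234567]%uint
  ++ flatten [seq SF i [:: ∅; 1234567]%uint | i <- [:: 4; 8; 9; 11; 12; 13]%N]
  ++ SF 6 [:: ∅; 7; 123456; 1234567]%uint
  ++ flatten [seq SF i [:: ∅; 4; 123567; 1234567]%uint | i <- [:: 7; 10]%N].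

Definition representatives : seq {set {set 'I_8}} :=
  list1 ++ list2 ++ list3 ++ list4 ++ list5.

(* Main.v *)
(* A graded isomorphism permutes the components L_i by a permutation s of I_0.
   As no two components have zero bracket, s carries T onto T' and satisfies
   s (i * j) = s i * s j whenever ij is in T; a multiset of vertex weights
   that only depends on T up to such permutations takes 215 different values
   on the list.

   Conversely, two kinds of isomorphisms suffice.  A collineation of Z_2^3
   lifts to a signed permutation of the e_i which is an automorphism of the
   octonions.  Moreover the automorphism phi with e_1 |-> e_1, e_2 |-> e_5 and
   e_3 |-> e_3 fixes L_0 and L_1 pointwise and exchanges L_2 and L_5; acting by
   phi on L_2 and L_5 and trivially on the other components is compatible with
   every bracket [L_i, L_j] such that i, j, i * j all belong to {0, 1, 2, 5} or
   all lie outside {2, 5}.  The conditions defining generalised nice sets are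
   Horn clauses, so their closed sets can be enumerated by branching with
   propagation, and each of them is brought to the list by these moves. *)

From HB Require Import structures.
Require Import Defs.
From mathcomp Require Import all_boot all_order all_algebra.

Set Implicit Arguments.
Unset Strict Implicit.
Unset Printing Implicit Defensive.

Import GRing.Theory.

(** * The representatives *)

(** Collineations alone leave too many classes: {12,13,17} and {12,13,14} are not collinear, since
    g_2 + g_3 + g_7 = 0 while g_2 + g_3 + g_4 = g_1. Exchanging L_2 and L_5 turns the former into
    {15,13,17}, which is collinear to the latter. Such an exchange can exist because an isomorphism
    has to respect only the brackets indexed by T, so it may be defined differently on different
    components. The bracket of two homogeneous elements is known only to have the right degree in
    the ambient space ([br_hom]). Its invariance under phi, or its membership in a component, is
    therefore read off from an explicit formula for that bracket. The witnesses of non-zero brackets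
    are built from symmetric integer matrices times e_0, which lie in J for each of the four Hurwitz
    algebras, so one argument serves all of them. Finite sets do not reduce, so the combinatorial
    half runs on lists and tries that are proved to describe the same sets. *)

Lemma set2_eqP (i j k l : 'I_8) :
  reflect ((i = k /\ j = l) \/ (i = l /\ j = k)) ([set i; j] == [set k; l]).
Proof.
apply: (iffP eqP) => [e | [[-> ->] // | [-> ->]]]; last by rewrite setUC.
have := set21 i j; have := set22 i j; have := set21 k l; have := set22 k l.
rewrite e -{1 2}e !in_set2.
by do 4!(case/orP=> /eqP ?); intuition congruence.
Qed.

(* Subsets of X0 are represented by tries, in which membership computes. *)
Inductive trie := Leaf | Node of bool & trie & trie.

Fixpoint tmem (p : seq bool) (t : trie) {struct t} : bool :=
  if t isn't Node b l r then false else
  if p is c :: p' then tmem p' (if c then l else r) else b.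

Fixpoint tadd (p : seq bool) (t : trie) : trie :=
  let: (b, l, r) := if t is Node b l r then (b, l, r) else (false, Leaf, Leaf) in
  if p isn't c :: p' then Node true l r else
  if c then Node b (tadd p' l) r else Node b l (tadd p' r).

Lemma tmem_add p q t : tmem p (tadd q t) = (p == q) || tmem p t.
Proof.
elim: q p t => [|c q IH] p t.
  by case: t p => [|b l r] [|[] p].
by case: t c p => [|b l r] [] [|[] p] //=; rewrite ?IH ?eqseq_cons ?orbF.
Qed.

Arguments tmem : simpl never.
Arguments tadd : simpl never.

Definition bits3 (n : nat) : seq bool := [:: odd n; odd n./2; odd n./2./2].

Definition pair_path (i j : 'I_8) : seq bool :=
  bits3 (minn i j) ++ bits3 (maxn i j).

Lemma pair_pathC i j : pair_path i j = pair_path j i.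
Proof. by rewrite /pair_path minnC maxnC. Qed.

Lemma bits3_inj m n : m < 8 -> n < 8 -> bits3 m = bits3 n -> m = n.
Proof. by do 8?[case: m => [|m]] => //; do 8?[case: n => [|n]]. Qed.

Lemma pair_path_eq i j k l :
  (pair_path i j == pair_path k l) = ([set i; j] == [set k; l]).
Proof.
apply/eqP/set2_eqP => [/eqP | [[-> ->] // | [-> ->]]]; last exact: pair_pathC.
have lt8 (x y : 'I_8) : (minn x y < 8) && (maxn x y < 8).
  by rewrite gtn_max gtn_min !ltn_ord.
have /andP[??] := lt8 i j; have /andP[??] := lt8 k l.
rewrite eqseq_cat // => /andP[/eqP/bits3_inj e /eqP/bits3_inj e'].
have {}e : minn i j = minn k l by exact: e.
have {}e' : maxn i j = maxn k l by exact: e'.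
move: e e'; rewrite /minn /maxn.
by do 2!case: ltnP => _; move=> /val_inj-> /val_inj->; auto.
Qed.

Definition trie_set (m : trie) : {set {set 'I_8}} :=
  [set [set p.1; p.2] | p : 'I_8 * 'I_8 in [pred p | tmem (pair_path p.1 p.2) m]].

Lemma mem_trie_set m i j : ([set i; j] \in trie_set m) = tmem (pair_path i j) m.
Proof.
apply/imsetP/idP => [[[k l]] | ij]; last by exists (i, j).
rewrite inE /= => kl /eqP; rewrite -pair_path_eq => /eqP e.
by rewrite e.
Qed.

Lemma mem_X0 i j : [set i; j] \in X0.
Proof. by apply/imsetP; exists (i, j). Qed.

Lemma sub_X0_ext (A B : {set {set 'I_8}}) : A \subset X0 -> B \subset X0 ->
  (forall i j, ([set i; j] \in A) = ([set i; j] \in B)) -> A = B.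
Proof.
move=> /subsetP sA /subsetP sB AB; apply/setP => x.
case: (boolP (x \in X0)) => [/imsetP[[i j] _ ->] // | xX].
by rewrite (contraNF (sA x)) // (contraNF (sB x)).
Qed.

Lemma trie_set_sub m : trie_set m \subset X0.
Proof. by apply/subsetP => _ /imsetP[[i j] _ ->]; apply: mem_X0. Qed.

Lemma trie_set_add m i j :
  trie_set (tadd (pair_path i j) m) = [set i; j] |: trie_set m.
Proof.
apply: sub_X0_ext => [||k l]; first exact: trie_set_sub.
  by apply/subsetP => x /setU1P[-> | /(subsetP (trie_set_sub m))//]; apply: mem_X0.
by rewrite in_setU1 !mem_trie_set tmem_add pair_path_eq.
Qed.

Lemma trie_set_leaf : trie_set Leaf = set0.
Proof. by apply/setP => x; rewrite inE; apply/imsetP => -[[i j]]; rewrite inE. Qed.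

Definition pair_set (p : nat * nat) : {set 'I_8} := [set ix p.1; ix p.2].

Definition trie_of_code (c : seq (nat * nat)) : trie :=
  foldr (fun p => tadd (pair_path (ix p.1) (ix p.2))) Leaf c.

Lemma trie_set_of_code c : trie_set (trie_of_code c) = [set:: map pair_set c].
Proof.
elim: c => [|p c IH] /=; first by rewrite trie_set_leaf set_nil.
by rewrite trie_set_add set_cons IH.
Qed.

Definition uint_pairs (s : seq Number.uint) : seq (nat * nat) :=
  [seq (nth 0 (digits d) 0, nth 0 (digits d) 1) | d <- s].

Lemma pairsE s : all (fun d => size (digits d) == 2) s ->
  pairs s = [set:: map pair_set (uint_pairs s)].
Proof.
move=> s2; rewrite /pairs; suff -> : map dset s = map pair_set (uint_pairs s) by [].
elim: s s2 => [|d s IH] //= /andP[d2 /IH->]; congr cons.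
rewrite /dset /pair_set /=; case: (digits d) d2 => [|a [|b [|]]] //= _.
by rewrite !set_cons set_nil setU0.
Qed.

Lemma dset_imset (f : 'I_8 -> {set 'I_8}) d :
  [set f i | i in dset d] = [set:: [seq f (ix a) | a <- digits d]].
Proof.
apply/setP => x; rewrite inE; apply/imsetP/mapP => [[i] | [a aD ->]].
  by rewrite inE => /mapP[a aD ->] ->; exists a.
by exists (ix a) => //; rewrite inE map_f.
Qed.

Definition E_code (d : Number.uint) := [seq (a, a) | a <- digits d].
Definition F_code (d : Number.uint) := (0, 0) :: [seq (0, a) | a <- digits d].

Lemma ix0 : ix 0 = ord0. Proof. exact: val_inj. Qed.

Lemma E_E d : E_ (dset d) = [set:: map pair_set (E_code d)].
Proof. by rewrite /E_ dset_imset /E_code -map_comp. Qed.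

Lemma F_E d : F_ (dset d) = [set:: map pair_set (F_code d)].
Proof.
rewrite /F_ dset_imset /F_code map_cons set_cons -map_comp {1}/pair_set ix0.
suff -> : map (pair_set \o pair 0) (digits d)
  = [seq [set ord0; ix a] | a <- digits d] by [].
by apply: eq_map => a; rewrite /pair_set /= ix0.
Qed.

Lemma P0_E j : P0_ j = [set:: map pair_set [:: (0, 0); (0, j); (j, j)]].
Proof.
rewrite /P0_ /P_ /= /pair_set /= ix0 !set_cons set_nil setU0.
have -> : star (ix j) (ix j) = ord0 by apply/eqP; rewrite star_eq0.
have -> : star ord0 (ix j) = ix j by rewrite starC star0.
rewrite star0 [[set ix j; ord0]]setUC.
move: [set ord0; ord0] [set ord0; ix j] [set ix j; ix j] => A B C.
by apply/setP => x; rewrite !inE; case: (x == A); case: (x == B); case: (x == C).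
Qed.

Definition S_code (i : nat) : seq (nat * nat) :=
  match i with
  | 1 => uint_pairs [:: 12]%uint
  | 2 => uint_pairs [:: 12; 13]%uint
  | 3 => uint_pairs [:: 12; 67]%uint
  | 4 => uint_pairs [:: 12; 13; 14]%uint
  | 6 => uint_pairs [:: 12; 16; 26]%uint
  | 7 => uint_pairs [:: 12; 16; 67]%uint
  | 8 => uint_pairs [:: 25; 36; 47]%uint
  | 9 => uint_pairs [:: 12; 16; 17; 26]%uint
  | 10 => uint_pairs [:: 12; 16; 27; 67]%uint
  | 11 => uint_pairs [:: 12; 16; 17; 26; 27]%uint
  | 12 => uint_pairs [:: 34; 36; 37; 46; 47; 67]%uint
  | 13 => uint_pairs [:: 12; 23; 31; 17; 26; 35]%uint
  | _ => [::]
  end.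

Lemma S_E i : S_ i = [set:: map pair_set (S_code i)].
Proof.
by do 14?[case: i => [|i]]; rewrite /S_code /S_; do [exact: pairsE | rewrite /= set_nil].
Qed.

Definition cross (s t : seq nat) : seq (nat * nat) := [seq (a, b) | a <- s, b <- t].

Definition Y7_code := uint_pairs [:: 00; 01; 02; 05; 11; 12; 15]%uint.
Definition Y10_code := uint_pairs [:: 00; 01; 02; 05; 11; 12; 15; 22; 25; 55]%uint.
Definition Y11_code :=
  (0, 0) :: cross [:: 0] (digits 12356%uint) ++ cross [:: 1] (digits 12356%uint).
Definition Y15_code :=
  (0, 0) :: cross [:: 0] (digits 1234567%uint) ++ cross [:: 1] (digits 1234567%uint).
Definition Y19_code := Y15_code ++ uint_pairs [:: 23; 35; 26; 56]%uint.
Definition X0_code := cross (iota 0 8) (iota 0 8).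
(** The complement of the pairs inside {3,4,6,7} consists of the pairs that meet {0,1,2,5}. *)
Definition Y26_code := cross [:: 0; 1; 2; 5] (iota 0 8).

Lemma set_cat (T : finType) (s t : seq T) : [set:: s ++ t] = [set:: s] :|: [set:: t].
Proof. by apply/setP => x; rewrite !inE mem_cat. Qed.

Lemma ixK (i : 'I_8) : ix i = i.
Proof. exact: valZpK. Qed.

Lemma cross_mem (s t : seq nat) i j : all (ltn^~ 8) s -> all (ltn^~ 8) t ->
  ([set i; j] \in [set:: map pair_set (cross s t)]) =
  ((i : nat) \in s) && ((j : nat) \in t) || ((j : nat) \in s) && ((i : nat) \in t).
Proof.
move=> /allP s8 /allP t8; rewrite inE.
have vix (k : 'I_8) a : a < 8 -> k = ix a -> k = a :> nat.
  by move=> a8 ->; rewrite /= modn_small.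
apply/mapP/orP => [[[a b] /allpairsP[[a' b'] /= [as_ bt [-> ->]]]]|].
  move=> /eqP/set2_eqP[[/(vix _ _ (s8 _ as_)) ia /(vix _ _ (t8 _ bt)) jb]|].
    by left; rewrite ia jb as_.
  case=> /(vix _ _ (t8 _ bt)) ib /(vix _ _ (s8 _ as_)) ja.
  by right; rewrite ib ja as_.
case=> /andP[is_ jt].
  by exists (i : nat, j : nat); [exact: allpairs_f | rewrite /pair_set /= !ixK].
by exists (j : nat, i : nat); [exact: allpairs_f | rewrite /pair_set /= !ixK setUC].
Qed.

Lemma cross1_E x d :
  [set [set ix x; i] | i in dset d] = [set:: map pair_set (cross [:: x] (digits d))].
Proof. by rewrite dset_imset /cross /= cats0 -map_comp. Qed.

Lemma cross_E c d : [set [set k; l] | k in dset c, l in dset d]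
  = [set:: map pair_set (cross (digits c) (digits d))].
Proof.
apply/setP => x; rewrite [RHS]inE; apply/imset2P/mapP => [[k l]|[p]].
  rewrite !inE => /mapP[a ac ->] /mapP[b bd ->] ->.
  by exists (a, b); first exact: allpairs_f.
case/allpairsP=> -[a b] [/= ac bd ->] ->.
by exists (ix a) (ix b) => //; rewrite inE map_f.
Qed.

Lemma cY_cons c d d' :
  [set:: map pair_set ((0, 0) :: cross [:: c] (digits d) ++ cross [:: c.+1] (digits d'))]
  = pairs [:: 00]%uint :|: [set [set ix c; i] | i in dset d]
    :|: [set [set ix c.+1; i] | i in dset d'].
Proof. by rewrite !cross1_E pairsE // -!set_cat -!map_cat. Qed.

Lemma Y11_E : Y11 = [set:: map pair_set Y11_code].
Proof. by rewrite cY_cons ix0. Qed.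

Lemma Y15_E : Y15 = [set:: map pair_set Y15_code].
Proof. by rewrite cY_cons ix0. Qed.

Lemma Y19_E : Y19 = [set:: map pair_set Y19_code].
Proof. by rewrite /Y19 Y15_E pairsE // -set_cat -map_cat. Qed.

Lemma psets_sub c : [set:: map pair_set c] \subset X0.
Proof. by apply/subsetP=> x; rewrite inE => /mapP[p _ ->]; apply: mem_X0. Qed.

Lemma X0_E : X0 = [set:: map pair_set X0_code].
Proof.
apply: sub_X0_ext => // [|i j]; first exact: psets_sub.
by rewrite cross_mem // mem_X0 !mem_iota !ltn_ord.
Qed.

Lemma Y26_E : Y26 = [set:: map pair_set Y26_code].
Proof.
apply: sub_X0_ext => [||i j]; [exact: subsetDl | exact: psets_sub |].
rewrite cross_mem // in_setD mem_X0 cross_E cross_mem //.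
by case: i => [[|[|[|[|[|[|[|[|//]]]]]]]] ?];
  case: j => [[|[|[|[|[|[|[|[|//]]]]]]]] ?].
Qed.

Definition SE_code i s := [seq S_code i ++ E_code d | d <- s].
Definition SF_code i s := [seq S_code i ++ F_code d | d <- s].

(** A mirror of [representatives] on which [vm_compute] can work; [representatives_E] identifies the
    two. *)
Definition rep_codes : seq (seq (nat * nat)) :=
  [:: Y7_code; Y10_code; Y11_code; Y15_code; Y19_code; Y26_code; X0_code]
  ++ [:: [:: (0, 0); (0, 1); (1, 1)];
         S_code 1 ++ [:: (0, 0); (0, 3); (3, 3)];
         S_code 2 ++ [:: (0, 0); (0, 4); (4, 4)];
         S_code 3 ++ [:: (0, 0); (0, 3); (3, 3)];
         S_code 6 ++ [:: (0, 0); (0, 7); (7, 7)];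
         S_code 7 ++ [:: (0, 0); (0, 4); (4, 4)];
         S_code 10 ++ [:: (0, 0); (0, 4); (4, 4)]]
  ++ (let s := [:: ∅; 1; 12; 123; 1234; 12345; 123456; 1234567]%uint in
      [seq E_code d | d <- s] ++ [seq F_code d | d <- s])
  ++ (SE_code 1 [:: ∅; 1; 3; 12; 13; 34; 123; 134; 346; 1234; 3467; 1367; 12346; 13467;
           123467]%uint
  ++ SE_code 2 [:: ∅; 1; 2; 4; 12; 14; 23; 24; 47; 123; 124; 234; 247; 147; 1234;
              1247; 2347; 12347]%uint
  ++ SE_code 3 [:: ∅; 1; 3; 12; 13; 16; 34; 123; 126; 134; 136; 1234; 1267; 1236;
              1346; 12346; 12367; 123467]%uint
  ++ SE_code 4 [:: ∅; 1; 2; 12; 23; 123; 234; 1234]%uint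
  ++ SE_code 6 [:: ∅; 1; 7; 12; 17; 126; 127; 1267]%uint
  ++ SE_code 7 [:: ∅; 1; 2; 4; 12; 14; 16; 17; 24; 27; 124; 126; 127; 146; 247; 147;
              1267; 1246; 1247; 12467]%uint
  ++ SE_code 8 [:: ∅; 2; 23; 25; 234; 235; 2356; 2345; 23456; 234567]%uint
  ++ SE_code 9 [:: ∅; 1; 2; 7; 12; 17; 26; 27; 126; 127; 267; 1267]%uint
  ++ SE_code 10 [:: ∅; 1; 4; 12; 14; 17; 124; 126; 147; 1267; 1246; 12467]%uint
  ++ SE_code 11 [:: ∅; 1; 6; 12; 16; 67; 126; 167; 1267]%uint
  ++ SE_code 12 [:: ∅; 3; 34; 346; 3467]%uint
  ++ SE_code 13 [:: ∅; 1; 12; 123]%uint)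
  ++ (SF_code 1 [:: ∅; 3; 34; 125; 347; 3467; 1235; 12567; 123456; 1234567]%uint
  ++ SF_code 2 [:: ∅; 4; 47; 12356; 123456; 1234567]%uint
  ++ SF_code 3 [:: ∅; 3; 34; 12567; 123567; 1234567]%uint
  ++ flatten [seq SF_code i [:: ∅; 1234567]%uint | i <- [:: 4; 8; 9; 11; 12; 13]%N]
  ++ SF_code 6 [:: ∅; 7; 123456; 1234567]%uint
  ++ flatten [seq SF_code i [:: ∅; 4; 123567; 1234567]%uint | i <- [:: 7; 10]%N]).

Lemma SE_E i s : SE i s = map (trie_set \o trie_of_code) (SE_code i s).
Proof.
rewrite /SE /SE_code -map_comp; apply: eq_map => d.
by rewrite /= trie_set_of_code S_E E_E -set_cat -map_cat.
Qed.

Lemma SF_E i s : SF i s = map (trie_set \o trie_of_code) (SF_code i s).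
Proof.
rewrite /SF /SF_code -map_comp; apply: eq_map => d.
by rewrite /= trie_set_of_code S_E F_E -set_cat -map_cat.
Qed.

Lemma list1_E : list1 = map (trie_set \o trie_of_code)
  [:: Y7_code; Y10_code; Y11_code; Y15_code; Y19_code; Y26_code; X0_code].
Proof.
rewrite /list1 /Y7 /Y10 !pairsE // Y11_E Y15_E Y19_E Y26_E X0_E.
by rewrite -!trie_set_of_code.
Qed.

Lemma representatives_E : representatives = map (trie_set \o trie_of_code) rep_codes.
Proof.
rewrite /representatives /rep_codes !map_cat.
congr (_ ++ (_ ++ (_ ++ (_ ++ _)))).
- exact: list1_E.
- by rewrite /list2 !P0_E !S_E -!set_cat -!map_cat -!trie_set_of_code.
- rewrite /list3 -!map_comp; congr (_ ++ _); apply: eq_map => d.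
    by rewrite /= E_E trie_set_of_code.
  by rewrite F_E -trie_set_of_code.
- by rewrite /list4 !SE_E.
have flatE l s : flatten [seq SF i s | i <- l]
    = map (trie_set \o trie_of_code) (flatten [seq SF_code i s | i <- l]).
  rewrite map_flatten -map_comp; congr flatten.
  by apply: eq_map => i; rewrite SF_E.
by rewrite /list5 !flatE !SF_E !map_cat.
Qed.

Lemma size_reps : size representatives = 215.
Proof. by rewrite representatives_E size_map; vm_compute. Qed.

(** * Enumeration of the generalised nice sets *)

Definition I8 : seq 'I_8 := [seq ix n | n <- iota 0 8].

Lemma mem_I8 i : i \in I8.
Proof. by apply/mapP; exists (i : nat); rewrite ?mem_iota ?ltn_ord ?ixK. Qed.

Lemma all_I8P (P : pred 'I_8) : reflect (forall i, P i) (all P I8).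
Proof. by apply: (iffP allP) => [H i | H i _]; [apply/H/mem_I8 | apply: H]. Qed.

Definition rule (i j k : 'I_8) : seq bool * (seq bool * seq (seq bool)) :=
  (pair_path i j, (pair_path (star i j) k,
    [:: pair_path i j; pair_path j k; pair_path k i;
        pair_path i (star j k); pair_path j (star k i); pair_path k (star i j)])).

Definition rules : seq (seq bool * (seq bool * seq (seq bool))) :=
  [seq rule p.1 p.2 k | p <- [seq (i, j) | i <- I8, j <- I8], k <- I8].

(** A conditional rather than [==>]: the virtual machine evaluates the arguments of a boolean
    connective eagerly, and most premises fail. *)
Definition obeys (t : seq bool -> bool)
    (r : seq bool * (seq bool * seq (seq bool))) : bool :=
  if t r.1 && t r.2.1 then all t r.2.2 else true.

Lemma niceE (t : seq bool -> bool) (T : {set {set 'I_8}}) :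
    (forall i j, t (pair_path i j) = ([set i; j] \in T)) ->
  generalised_nice T = (T \subset X0) && all (obeys t) rules.
Proof.
move=> tT; congr (_ && _); apply/forallP/allP => [H r | H i].
  case/allpairsP=> -[[i j] k] [/= _ _ ->].
  move/forallP: (H i) => /(_ j)/forallP/(_ k).
  rewrite /obeys /= !tT; case: ifP => //= _.
  by rewrite /P_ !subUset !sub1set -!andbA !andbT.
apply/forallP => j; apply/forallP => k.
have /H: rule i j k \in rules.
  by apply: (allpairs_f _ (x := (i, j))); rewrite ?mem_I8 // allpairs_f ?mem_I8.
rewrite /obeys /= !tT; case: ifP => //= _.
by rewrite /P_ !subUset !sub1set -!andbA !andbT.
Qed.

Lemma reps_nice_comp :
  all (fun c => all (obeys (tmem^~ (trie_of_code c))) rules) rep_codes.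
Proof. by vm_cast_no_check (erefl true). Qed.

Lemma reps_nice T : T \in representatives -> generalised_nice T.
Proof.
rewrite representatives_E => /mapP[c cr ->].
rewrite (@niceE (tmem^~ (trie_of_code c))) => [|i j]; last by rewrite mem_trie_set.
by rewrite trie_set_sub; apply: (allP reps_nice_comp).
Qed.

(** * An isomorphism invariant separating the representatives *)

Section Invariant.

Variable t : 'I_8 -> 'I_8 -> bool.

Definition weight0 (i : 'I_8) : nat := (t i i).+1.

(** The product i * j enters only for ij in T, so a bijection that is multiplicative on the pairs of
    T preserves the weights. The coefficients serve to keep the 215 multisets apart, which
    [weights_reps_comp] verifies. *)
Definition weight (i : 'I_8) : nat :=
  weight0 i ^ 2
  + sumn [seq if t i j then weight0 j + 2 * weight0 (star i j) else 0 | j <- I8].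

Definition weights : seq nat := sort leq [seq weight i | i <- I8].

End Invariant.

Lemma perm_I8 (s : 'I_8 -> 'I_8) : injective s -> perm_eq (map s I8) I8.
Proof.
move=> s_inj; apply: uniq_perm.
- by rewrite (map_inj_uniq s_inj).
- by [].
move=> i; rewrite mem_I8; apply/mapP.
by exists (invF s_inj i); rewrite ?mem_I8 ?f_invF.
Qed.

Lemma weights_inv (t t' : 'I_8 -> 'I_8 -> bool) (s : 'I_8 -> 'I_8) : injective s ->
    (forall i j, t i j = t' (s i) (s j)) ->
    (forall i j, t i j -> s (star i j) = star (s i) (s j)) ->
  weights t = weights t'.
Proof.
move=> s_inj ts ss.
have w0 i : weight0 t i = weight0 t' (s i) by rewrite /weight0 ts.
have w i : weight t i = weight t' (s i).
  rewrite /weight w0; congr (_ + _).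
  rewrite -[RHS](perm_sumn (perm_map _ (perm_I8 s_inj))).
  rewrite -(map_comp _ s).
  congr sumn; apply: eq_map => j /=; rewrite -ts; case: ifP => // /ss e.
  by rewrite !w0 e.
apply/perm_sortP; [exact: leq_total | exact: leq_trans | exact: anti_leq |].
have -> : map (weight t) I8 = map (weight t') (map s I8).
  by rewrite -(map_comp _ s); apply: eq_map.
by apply: perm_map; apply: perm_I8.
Qed.

Definition has_pair (T : {set {set 'I_8}}) i j := [set i; j] \in T.

Lemma eq_weights t t' : (forall i j, t i j = t' i j) -> weights t = weights t'.
Proof. by move=> e; apply: (@weights_inv _ _ id). Qed.

Lemma weights_reps_comp :
  uniq [seq weights (fun i j => tmem (pair_path i j) m) | m <- map trie_of_code rep_codes].
Proof. by vm_compute. Qed.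

Lemma weights_reps : uniq [seq weights (has_pair T) | T <- representatives].
Proof.
have := weights_reps_comp; rewrite representatives_E -!map_comp.
rewrite (@eq_map _ _ _ (fun c => weights (has_pair (trie_set (trie_of_code c))))) // => c /=.
by apply: eq_weights => i j; rewrite /has_pair mem_trie_set.
Qed.

Lemma uniq_reps : uniq representatives.
Proof. exact: map_uniq weights_reps. Qed.

Lemma uniq_map_inj_in (A B : eqType) (f : A -> B) (s : seq A) :
  uniq (map f s) -> {in s &, injective f}.
Proof.
elim: s => //= a s IH /andP[fa /IH {}IH] x y.
rewrite !inE => /orP[/eqP-> | xs] /orP[/eqP-> | ys] // e; last exact: IH.
  by rewrite e map_f in fa.
by rewrite -e map_f in fa.
Qed.

Lemma reps_noniso (T T' : {set {set 'I_8}}) (s : 'I_8 -> 'I_8) :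
    T \in representatives -> T' \in representatives -> injective s ->
    (forall i j, ([set i; j] \in T) = ([set s i; s j] \in T')) ->
    (forall i j, [set i; j] \in T -> s (star i j) = star (s i) (s j)) ->
  T = T'.
Proof.
move=> TR TR' s_inj ts ss; apply: (uniq_map_inj_in weights_reps) => //=.
exact: (weights_inv s_inj ts ss).
Qed.

(** * Exhaustive search over the closed sets of a system of Horn clauses *)

Section Enumeration.

(* An entry (y, zs) at slot x of the table is the Horn clause x, y -> zs. *)
Variables (table : seq (seq (seq bool * seq (seq bool)))) (fuel : nat).
Variable P : trie -> bool.

(** The binary value, lowest bit first: the path of a pair lands in slot min + 8 max. *)
Definition slot (x : seq bool) := foldr (fun (b : bool) n => b + n.*2) 0 x.

Fixpoint saturate (n : nat) (No Y : trie) (st : seq (seq bool)) : option trie :=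
  if n isn't n'.+1 then Some Y else
  if st isn't x :: st' then Some Y else
  if tmem x Y then saturate n' No Y st' else
  if tmem x No then None else
  let Y' := tadd x Y in
  saturate n' No Y'
    (foldr (fun e acc => if tmem e.1 Y' then
                           [seq z <- e.2 | ~~ tmem z Y'] ++ acc
                         else acc) st' (nth [::] table (slot x))).

(* P holds for all closed sets containing Y and disjoint from No; l lists the
   undecided pairs.  A lack of fuel only makes the set returned by saturate
   smaller. *)
Fixpoint all_closed (l : seq (seq bool)) (Y No : trie) : bool :=
  if l isn't x :: l' then P Y else
  if tmem x Y then all_closed l' Y No else
  if all_closed l' Y (tadd x No) then
    if saturate fuel No Y [:: x] is Some Y' then
      all_closed l' (tadd x Y') No
    else true
  else false.

Variable t : seq bool -> bool.

Hypothesis tableP : forall x e, e \in nth [::] table (slot x) ->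
  t x -> t e.1 -> all t e.2.

Lemma tadd_sub Y x : (forall y, tmem y Y -> t y) -> t x ->
  forall y, tmem y (tadd x Y) -> t y.
Proof. by move=> Yt tx y; rewrite tmem_add => /orP[/eqP-> // | /Yt]. Qed.

(** Everything derived from elements of the closed set t stays in t, hence never meets [No]; so the
    result [None] cannot occur. *)
Lemma saturateP n No Y st :
    (forall x, tmem x Y -> t x) -> (forall x, tmem x No -> ~~ t x) ->
    all t st ->
  if saturate n No Y st is Some Y' then
    (forall x, tmem x Y' -> t x) /\ (forall x, tmem x Y -> tmem x Y')
  else False.
Proof.
elim: n Y st => //= n IH Y [//|x st] Yt Nt /= /andP[tx tst].
case: ifP => _; first exact: IH.
case: ifP => [/Nt | _]; first by rewrite tx.
have Yt' := tadd_sub Yt tx.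
set st' := foldr _ _ _; suff tst' : all t st'.
  have := IH _ _ Yt' Nt tst'; case: saturate => // Y' [Y't YY']; split=> // y yY.
  by rewrite YY' // tmem_add yY orbT.
rewrite /st'.
(* The induction runs over the list being folded; the inclusion into the original slot is kept so
   that [tableP] still applies to each entry. *)
have: {subset nth [::] table (slot x) <= nth [::] table (slot x)} by [].
elim: {1 3}(nth _ _ _) => //= e s IHs es.
have /IHs {}IHs : {subset s <= nth [::] table (slot x)}.
  by move=> y ys; apply: es; rewrite inE ys orbT.
case: ifP => // /Yt' te; rewrite all_cat IHs andbT all_filter.
have /allP: all t e.2 by apply: (tableP (es e (mem_head _ _))).
by move=> H; apply/allP => z /H tz; apply/implyP.
Qed.

(** Soundness: the set t selects a branch at each undecided pair, and Y below t, [No] disjoint from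
    t are invariants along it. At the leaf nothing is undecided, so Y is t. Other leaves may hold
    sets that are not closed, which only strengthens what is checked. *)
Lemma all_closedP l Y No : all_closed l Y No ->
    (forall x, tmem x Y -> t x) ->
    (forall x, tmem x No -> ~~ t x) ->
    (forall x, t x -> tmem x Y || (x \in l)) ->
  exists2 m, P m & forall x, tmem x m = t x.
Proof.
elim: l Y No => [|x l IH] Y No /=.
  move=> PY Yt _ tY; exists Y => // x; apply/idP/idP; first exact: Yt.
  by move/tY; rewrite orbF.
case: ifP => [Yx c Yt Nt tY | _].
  apply: (IH _ _ c) => // y /tY; rewrite inE.
  by case/or3P=> [-> // | /eqP-> | ->]; rewrite ?Yx ?orbT.
case: ifP => // c1 c2 Yt Nt tY; case: (boolP (t x)) => tx; last first.
  apply: (IH _ _ c1) => // [y | y ty].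
    by rewrite tmem_add => /orP[/eqP-> // | /Nt].
  move/tY: (ty); rewrite inE; case/or3P=> [-> // | /eqP e | ->]; last by rewrite orbT.
  by rewrite -e ty in tx.
have := @saturateP fuel No Y [:: x] Yt Nt; rewrite /= tx => /(_ isT).
case: (saturate _ _ _ _) c2 => // Y' c2 [Y't YY'].
apply: (IH _ _ c2) => // y; first exact: tadd_sub.
move/tY; rewrite tmem_add inE.
by case/or3P=> [/YY'-> | -> | ->]; rewrite ?orbT.
Qed.

End Enumeration.

(** * Data of the search: clauses, collineations and the swap *)

Definition I8_pairs : seq ('I_8 * 'I_8) :=
  [seq p : 'I_8 * 'I_8 <- [seq (i, j) | i <- I8, j <- I8] | p.1 <= p.2].

Lemma mem_I8_pairs i j : ((i, j) \in I8_pairs) || ((j, i) \in I8_pairs).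
Proof.
have mem_all (k l : 'I_8) : (k, l) \in [seq (i, j) | i <- I8, j <- I8].
  by apply: allpairs_f; apply: mem_I8.
by rewrite !mem_filter !mem_all !andbT leq_total.
Qed.

(** Each clause is filed under both of its premises, because [saturate] consults only the slot of
    the element just added and either premise may come last. *)
Definition rules_at (x : seq bool) : seq (seq bool * seq (seq bool)) :=
  undup ([seq r.2 | r <- rules & r.1 == x]
         ++ [seq (r.1, r.2.2) | r <- rules & r.2.1 == x]).

Definition rule_table :=
  [seq rules_at (bits3 n ++ bits3 n./2./2./2) | n <- iota 0 64].

(* Deciding the pairs in this order keeps the search tree small. *)
Definition all_paths : seq (seq bool) :=
  [seq pair_path p.1 p.2 | p <- [seq p <- I8_pairs | p.1 == p.2]
     ++ [seq p <- I8_pairs | (p.1 != p.2) && (p.1 == ord0)]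
     ++ [seq p <- I8_pairs | (p.1 != p.2) && (p.1 != ord0)]].

Definition perm_of (s : seq nat) (i : 'I_8) : 'I_8 := ix (nth 0 s i).

(* The linear maps of Z_2^3 sending g_1, g_2, g_3 to g_a, g_b, g_c. *)
Definition collineation (a b c : 'I_8) : seq nat :=
  [:: 0; val a; val b; val c; val (star (star a b) c);
      val (star a b); val (star a c); val (star b c)].

(** The filter keeps the ordered bases of Z_2^3, so these are the 168 elements of GL_3(2). *)
Definition collineations : seq (seq nat) :=
  [seq collineation p.1.1 p.1.2 p.2
    | p <- [seq p <- [seq (q, k) | q <- [seq (i, j) | i <- I8, j <- I8], k <- I8]
              | (ord0 \notin [:: p.1.1; p.1.2; p.2]) && (p.1.1 != p.1.2)
                && (p.2 \notin [:: p.1.1; p.1.2; star p.1.1 p.1.2])]].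

Definition swap25 (i : 'I_8) : 'I_8 := perm_of [:: 0; 1; 5; 3; 4; 2; 6; 7] i.

Definition near_line (i : 'I_8) : bool := i \in [:: ix 0; ix 1; ix 2; ix 5].
Definition off_swap (i : 'I_8) : bool := i \notin [:: ix 2; ix 5].

Definition swap_ok (i j : 'I_8) : bool :=
  all near_line [:: i; j; star i j] || all off_swap [:: i; j; star i j].

Lemma swap25K : involutive swap25.
Proof. by case=> [[|[|[|[|[|[|[|[|//]]]]]]]] ?]; apply: val_inj. Qed.

Lemma swap_okC i j : swap_ok i j = swap_ok j i.
Proof.
by rewrite /swap_ok starC /=; congr (_ || _); rewrite andbCA.
Qed.

Definition image_paths (f : 'I_8 -> 'I_8) : seq (seq bool) :=
  [seq pair_path (f p.1) (f p.2) | p <- I8_pairs].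

(** T contains one of these paths exactly when its pullback along [f] has a pair that is not
    [swap_ok]; the test thus needs no construction of the pullback. *)
Definition swap_bad (f : 'I_8 -> 'I_8) : seq (seq bool) :=
  [seq pair_path (f p.1) (f p.2) | p <- [seq p <- I8_pairs | ~~ swap_ok p.1 p.2]].

Definition swap_data : seq (seq (seq bool) * seq (seq bool)) :=
  [seq (swap_bad (perm_of s), image_paths (perm_of s \o swap25)) | s <- collineations].

Definition signature (m : trie) (src : seq (seq bool)) : seq bool :=
  [seq tmem x m | x <- src].

(** Characteristic vectors of all collinear images of the representatives. Used as keys of a trie,
    they turn the test for collinearity to a representative into a single lookup. *)
Definition rep_signatures : seq (seq bool) :=
  [seq signature (trie_of_code c) src | c <- rep_codes,
    src <- [seq image_paths (perm_of s) | s <- collineations]].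

(* The set m, or else its image under a collineation and an allowed swap25, is
   collinear to a representative. *)
Definition reaches (src0 : seq (seq bool))
    (data : seq (seq (seq bool) * seq (seq bool))) (reps : trie) (m : trie) :=
  if tmem (signature m src0) reps then true else
  has (fun d => if has (tmem^~ m) d.1 then false
                else tmem (signature m d.2) reps) data.

(** The whole classification up to the moves is this one computation; the tactic leaves a bare cast,
    so it runs only when the kernel checks the term. *)
Lemma all_nice_reach : all_closed rule_table 1000
  (reaches (image_paths id) swap_data (foldr tadd Leaf rep_signatures))
  all_paths Leaf Leaf.
Proof. by vm_cast_no_check (erefl true). Qed.

Definition pullback (f : 'I_8 -> 'I_8) (T : {set {set 'I_8}}) : {set {set 'I_8}} :=
  [set [set p.1; p.2] | p : 'I_8 * 'I_8 in [pred p | [set f p.1; f p.2] \in T]].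

Lemma mem_pullback f T i j :
  ([set i; j] \in pullback f T) = ([set f i; f j] \in T).
Proof.
apply/imsetP/idP => [[[k l]] | ij]; last by exists (i, j).
rewrite inE /= => kl /eqP/set2_eqP[[-> ->] // | [-> ->]].
by rewrite setUC.
Qed.

Lemma signature_inj m m' (f f' : 'I_8 -> 'I_8) :
    signature m (image_paths f) = signature m' (image_paths f') ->
  forall i j, tmem (pair_path (f i) (f j)) m = tmem (pair_path (f' i) (f' j)) m'.
Proof.
rewrite /signature /image_paths -!map_comp => /eq_in_map e i j.
by case/orP: (mem_I8_pairs i j) => /e //= H; rewrite pair_pathC H pair_pathC.
Qed.

Lemma tmem_foldr p l : tmem p (foldr tadd Leaf l) = (p \in l).
Proof. by elim: l => //= q l IH; rewrite tmem_add IH inE. Qed.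

Lemma slotK m n (x := bits3 m ++ bits3 n) :
  (slot x < 64) && (bits3 (slot x) ++ bits3 (slot x)./2./2./2 == x).
Proof.
rewrite {}/x {3 4}/bits3 {1 2 4 6}/bits3 [_ ++ _]/=.
move: (odd m) (odd m./2) (odd m./2./2) (odd n) (odd n./2) (odd n./2./2).
by do 6!case.
Qed.

Section Reach.

Variable T : {set {set 'I_8}}.
Hypothesis T_nice : generalised_nice T.

Let t (x : seq bool) : bool :=
  [exists p : 'I_8 * 'I_8, (pair_path p.1 p.2 == x) && ([set p.1; p.2] \in T)].

Lemma tE i j : t (pair_path i j) = ([set i; j] \in T).
Proof.
apply/existsP/idP => [[[k l] /= /andP[]] | ij]; last by exists (i, j); rewrite eqxx.
by rewrite pair_path_eq => /eqP->.
Qed.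

Lemma rule_tableP x e : e \in nth [::] rule_table (slot x) ->
  t x -> t e.1 -> all t e.2.
Proof.
move=> + tx; have [[i j] /= /andP[/eqP xE _]] := existsP tx; subst x.
have /andP[lt64 /eqP xE] := slotK (minn i j) (maxn i j).
rewrite (nth_map 0) ?size_iota // nth_iota // add0n xE mem_undup mem_cat.
have /andP[_ /allP ob] : (T \subset X0) && all (obeys t) rules.
  by rewrite -(niceE tE).
case/orP=> /mapP[r]; rewrite mem_filter => /andP[/eqP r1 /ob] + -> te;
  by rewrite /obeys r1 tx te.
Qed.

Lemma nice_reach :
  exists2 m, reaches (image_paths id) swap_data (foldr tadd Leaf rep_signatures) m
           & forall i j, ([set i; j] \in T) = tmem (pair_path i j) m.
Proof.
have [//|//|x|m mP mt] := all_closedP rule_tableP all_nice_reach.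
  case/existsP=> -[i j] /= /andP[/eqP<- _].
  have inall p : p \in I8_pairs -> pair_path p.1 p.2 \in all_paths.
    rewrite /all_paths; move: I8_pairs => l pl; apply/mapP; exists p => //.
    by rewrite !mem_cat !mem_filter pl !andbT; case: eqP => //= _; apply: orbN.
  move: all_paths inall (mem_I8_pairs i j) => l inall /orP[] /inall //=.
  by rewrite pair_pathC.
by exists m; [exact: mP | move=> i j; rewrite mt tE].
Qed.

End Reach.

(** * Reduction of every generalised nice set to a representative *)

Section Existence.

Variable R : {set {set 'I_8}} -> {set {set 'I_8}} -> Prop.

Hypothesis R_trans : forall T1 T2 T3, R T1 T2 -> R T2 T3 -> R T1 T3.
Hypothesis R_collineation : forall s T, s \in collineations ->
  R (pullback (perm_of s) T) T /\ R T (pullback (perm_of s) T).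
Hypothesis R_swap : forall T : {set {set 'I_8}},
  (forall i j, [set i; j] \in T -> swap_ok i j) -> R T (pullback swap25 T).

Lemma pullback_eq f (T T' : {set {set 'I_8}}) : T' \subset X0 ->
    (forall i j, ([set i; j] \in T') = ([set f i; f j] \in T)) ->
  T' = pullback f T.
Proof.
move=> sT e; apply: sub_X0_ext => // [|i j]; last by rewrite mem_pullback.
by apply/subsetP => _ /imsetP[[i j] _ ->]; apply: mem_X0.
Qed.

Lemma nice_rep T : generalised_nice T ->
  exists2 T', T' \in representatives & R T T'.
Proof.
move=> nT; have [m mR tm] := nice_reach nT.
have /andP[TX _] := nT.
have hit f (T' : {set {set 'I_8}}) :
    (forall i j, ([set i; j] \in T') = tmem (pair_path (f i) (f j)) m) ->
    T' \subset X0 -> tmem (signature m (image_paths f)) (foldr tadd Leaf rep_signatures) ->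
  exists2 T'', T'' \in representatives & R T' T''.
  move=> e sT'; rewrite tmem_foldr.
  case/allpairsP=> p [p_in /mapP[s s_col ->] /signature_inj es].
  exists (trie_set (trie_of_code p.1)).
    by rewrite representatives_E; exact: (map_f (trie_set \o trie_of_code) p_in).
  have -> : T' = pullback (perm_of s) (trie_set (trie_of_code p.1)).
    by apply: (pullback_eq sT') => i j; rewrite e es mem_trie_set.
  by have [] := R_collineation (trie_set (trie_of_code p.1)) s_col.
(* The trie of signatures is abstracted so that no simplification below starts to evaluate it. *)
move: (foldr _ _ _) hit mR => L hit; rewrite /reaches.
case: ifP => [h _ | _]; first exact: (hit id T tm TX h).
case/hasP=> -[bits src] + /=; case/mapP=> s s_col e.
have -> : bits = swap_bad (perm_of s) := congr1 fst e.
have -> : src = image_paths (perm_of s \o swap25) := congr1 snd e.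
case: ifP => // /negbT/hasPn ok h.
(* The collineation brings the pair of components to be exchanged to the standard position L_2,
   L_5. *)
pose U := pullback (perm_of s) T.
have U_ok i j : [set i; j] \in U -> swap_ok i j.
  have okp p : p \in I8_pairs -> [set p.1; p.2] \in U -> swap_ok p.1 p.2.
    rewrite mem_pullback tm => pI; apply: contraTT => bad.
    apply: ok; apply/mapP; exists p; last by [].
    by rewrite mem_filter bad pI.
  case/orP: (mem_I8_pairs i j) => /okp //= ji.
  by rewrite setUC swap_okC.
have [i j||T' T'rep RT'] := hit (perm_of s \o swap25) (pullback swap25 U) _ _ h.
- by rewrite !mem_pullback tm.
- by apply/subsetP => _ /imsetP[[i j] _ ->]; apply: mem_X0.
exists T' => //; have [_ RTU] := R_collineation T s_col.
exact: R_trans RTU (R_trans (R_swap U_ok) RT').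
Qed.

End Existence.

Local Open Scope ring_scope.

(** * Graded isomorphisms between graded contractions *)

Lemma starA i j k : star i (star j k) = star (star i j) k.
Proof. by apply: g_inj; rewrite !g_star addrA. Qed.

Lemma starii i : star i i = ord0.
Proof. by apply/eqP; rewrite star_eq0. Qed.

Lemma star0l i : star ord0 i = i.
Proof. by rewrite starC star0. Qed.

Lemma starKl i j : star i (star i j) = j.
Proof. by rewrite starA starii star0l. Qed.

Fact tensl_is_linear (F : fieldType) (V : vectType F) (d : 'End('rV[F]_8)) :
  linear (@tensl F V d).
Proof.
move=> k w w'; rewrite /tensl scaler_sumr -big_split; apply: eq_bigr => i _ /=.
by rewrite !ffunE linearPr.
Qed.
HB.instance Definition _ (F : fieldType) (V : vectType F) (d : 'End('rV[F]_8)) :=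
  GRing.isLinear.Build F {ffun 'I_8 -> V} {ffun 'I_8 -> V} _ (@tensl F V d)
    (tensl_is_linear d).

(** * The G-grading on the ambient space and on L *)

Section Grading.

Variables (F : fieldType).
Hypothesis charF0 : [pchar F] =i pred0.
Variable C : {vspace 'rV[F]_8}.

Local Notation oct := 'rV[F]_8.
Local Notation ob := (ob F).

Lemma natS_neq0 n : n.+1%:R != 0 :> F.
Proof. by have [/(_ charF0) ->] := pcharf0P F. Qed.

Lemma lfun_ob (V : vectType F) (d e : 'Hom(oct, V)) :
  (forall j, d (ob j) = e (ob j)) -> d = e.
Proof.
move=> de; apply/lfunP => a; rewrite (oct_sum_ob a) !linear_sum.
by apply: eq_bigr => j _; rewrite !linearZ /= de.
Qed.

Definition homogeneous (k : 'I_8) (d : 'End(oct)) :=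
  forall j, exists c, d (ob j) = c *: ob (star k j).

Lemma oend_comp_ob k d j :
  oend_comp k d (ob j) = d (ob j) 0 (star k j) *: ob (star k j).
Proof.
rewrite lfunE /= /oend_comp_fun (bigD1 j) //= obE eqxx mul1r.
by rewrite big1 ?addr0 // => i ij; rewrite obE (negbTE ij) mul0r scale0r.
Qed.

Lemma oend_comp_hom k d : homogeneous k d -> oend_comp k d = d.
Proof.
move=> dk; apply: lfun_ob => j; rewrite oend_comp_ob.
by have [c ->] := dk j; rewrite mxE obE eqxx mulr1.
Qed.

Lemma hom_oend_comp k (d : 'End(oct)) : homogeneous k (oend_comp k d).
Proof. by move=> j; rewrite oend_comp_ob; eexists. Qed.

Lemma sum_oend_comp (d : 'End(oct)) : d = \sum_k oend_comp k d.
Proof.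
apply: lfun_ob => j; rewrite sum_lfunE {1}(oct_sum_ob (d (ob j))).
rewrite (reindex_inj (@starIr j)) /=; apply: eq_bigr => k _.
by rewrite oend_comp_ob.
Qed.

Lemma Dcomp_hom k d : d \in Dcomp F k -> homogeneous k d.
Proof.
by move=> dk j; exists (d (ob j) 0 (star k j)); apply: Dcomp_ob.
Qed.

Lemma hom_Dcomp k d : d \in derO F -> homogeneous k d -> d \in Dcomp F k.
Proof.
move=> dO dk; apply/mem_Dcomp; split=> // j.
by have [c ->] := dk j; apply/memvZ/memv_line.
Qed.

Lemma hom_comm k l d e : homogeneous k d -> homogeneous l e ->
  homogeneous (star k l) (comm d e).
Proof.
move=> dk el j; rewrite /comm add_lfunE opp_lfunE !comp_lfunE.
have [a ea] := el j; have [b db] := dk (star l j).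
have [a' da'] := dk j; have [b' eb'] := el (star k j).
exists (a * b - a' * b'); rewrite ea da' !linearZ /= db eb' scalerN !scalerA.
by rewrite !starA (starC l k) -scalerBl.
Qed.

Lemma hom_lmul i : homogeneous i (lmul (@omul F) (ob i)).
Proof. by move=> j; exists (osgn F i j); rewrite lmulE /= omul_ob. Qed.

Lemma hom_rmul i : homogeneous i (rmul (@omul F) (ob i)).
Proof. by move=> j; exists (osgn F j i); rewrite rmulE /= omul_ob starC. Qed.

Lemma homD k d e : homogeneous k d -> homogeneous k e -> homogeneous k (d + e).
Proof.
move=> dk ek j; have [a da] := dk j; have [b eb] := ek j.
by exists (a + b); rewrite add_lfunE da eb scalerDl.
Qed.

Lemma homZ k c d : homogeneous k d -> homogeneous k (c *: d).
Proof.
by move=> dk j; have [a da] := dk j; exists (c * a); rewrite scale_lfunE da scalerA.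
Qed.

Lemma hom_oD i j : homogeneous (star i j) (oD (ob i) (ob j)).
Proof.
have hl := hom_lmul; have hr := hom_rmul.
by apply: homD; [apply: homD |]; apply: hom_comm.
Qed.

Lemma omulr_ob (a : oct) j l : omul a (ob j) 0 (star l j) = a 0 l * osgn F l j.
Proof.
rewrite {1}(oct_sum_ob a) linear_sumlz summxE (bigD1 l) //= linearZl_LR /=.
rewrite omul_ob !mxE eqxx eqxx mulr1 big1 ?addr0 // => i il.
rewrite linearZl_LR /= omul_ob !mxE eqxx /=; case: eqP => [/starIr e|_].
  by rewrite e eqxx in il.
by rewrite !mulr0.
Qed.

Lemma omull_ob (a : oct) j l : omul (ob j) a 0 (star l j) = a 0 l * osgn F j l.
Proof.
rewrite {1}(oct_sum_ob a) linear_sumr summxE (bigD1 l) //= linearZr_LR /=.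
rewrite omul_ob !mxE starC eqxx eqxx mulr1 big1 ?addr0 // => i il.
rewrite linearZr_LR /= omul_ob !mxE eqxx /= !(starC j).
case: eqP => [/starIr e|_]; first by rewrite e eqxx in il.
by rewrite !mulr0.
Qed.

(** The Leibniz rule with one argument fixed is an equality of linear maps between d and
    multiplication operators, so it extends from the basis one argument at a time. *)
Lemma mem_derO (d : 'End(oct)) :
    (forall i j, d (omul (ob i) (ob j))
                 = omul (d (ob i)) (ob j) + omul (ob i) (d (ob j))) ->
  d \in derO F.
Proof.
move=> dob.
pose L := lmul (@omul F); pose R := rmul (@omul F).
have dL i : (d \o L (ob i))%VF = L (d (ob i)) + (L (ob i) \o d)%VF.
  by apply: lfun_ob => j; rewrite add_lfunE !comp_lfunE !lmulE dob.
have dR y : (d \o R y)%VF = (R y \o d)%VF + R (d y).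
  apply: lfun_ob => i; have /lfunP/(_ y) := dL i.
  by rewrite !add_lfunE !comp_lfunE !rmulE !lmulE.
apply/mem_der => x y; have /lfunP/(_ x) := dR y.
by rewrite add_lfunE !comp_lfunE !rmulE.
Qed.

Lemma derO_ob0 d : d \in derO F -> d (ob ord0) = 0.
Proof.
move=> /mem_der/(_ (ob ord0) (ob ord0)) /=; rewrite !omul1 omulr1 => /eqP.
by rewrite -{1}[d _]addr0 (inj_eq (addrI _)) => /eqP <-.
Qed.

(** Here d(e_k) = c e_0, and applying d to e_k^2 = -1 gives 2 c e_k = 0. *)
Lemma Dcomp_self k d : k != ord0 -> d \in Dcomp F k -> d (ob k) = 0.
Proof.
move=> k0 dk; have [/mem_der dO _] := (mem_Dcomp k d).1 dk.
have dO' : d \in derO F by apply/mem_der.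
have [c dc] := Dcomp_hom dk k; rewrite starii in dc.
have := dO (ob k) (ob k); rewrite /= omul_ob_sqr // linearN /= derO_ob0 // oppr0.
rewrite dc linearZl_LR linearZr_LR /= omul1 omulr1 -scalerDr -mulr2n -scaler_nat.
move/esym/eqP; rewrite !scaler_eq0 (negbTE (natS_neq0 1)) /= => /orP[/eqP->|].
  by rewrite scale0r.
by move=> /eqP/rowP/(_ k)/eqP; rewrite obE eqxx mxE (negbTE (natS_neq0 0)).
Qed.

(** Here d(e_j) = c e_j, and applying d to e_j^2 = -1 gives -2 c e_0 = 0. Hence der(O) contributes
    nothing to L_0. *)
Lemma Dcomp0 d : d \in Dcomp F ord0 -> d = 0.
Proof.
move=> d0; apply: lfun_ob => j; rewrite lfunE /=.
have [/mem_der dO _] := (mem_Dcomp ord0 d).1 d0.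
have dO' : d \in derO F by apply/mem_der.
case: (eqVneq j ord0) => [-> | j0]; first exact: derO_ob0.
have [c dc] := Dcomp_hom d0 j; rewrite star0l in dc.
have := dO (ob j) (ob j); rewrite /= omul_ob_sqr // linearN /= derO_ob0 // oppr0.
rewrite dc linearZl_LR linearZr_LR /= omul_ob_sqr // -mulr2n -scaler_nat.
move/esym/eqP; rewrite !scaler_eq0 oppr_eq0 (negbTE (natS_neq0 1)) /=.
move=> /orP[/eqP->|]; first by rewrite scale0r.
by move=> /eqP/rowP/(_ ord0)/eqP; rewrite obE eqxx mxE (negbTE (natS_neq0 0)).
Qed.

(** The octonion product is graded, so the Leibniz rule for the degree k part is the coefficient of
    e_{k*i*j} in the rule for d at e_i, e_j. *)
Lemma oend_comp_der k d : d \in derO F -> oend_comp k d \in derO F.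
Proof.
move=> /mem_der dO; apply: mem_derO => i j.
have e1 : star k (star i j) = star (star k i) j := starA _ _ _.
have e2 : star k (star i j) = star (star k j) i by rewrite (starC i j) starA.
have /rowP/(_ (star k (star i j))) := dO (ob i) (ob j).
rewrite /= mxE {2}e1 omulr_ob e2 omull_ob -e2.
rewrite omul_ob linearZ [in X in X -> _]mxE linearZ /= !oend_comp_ob => de.
rewrite linearZl_LR linearZr_LR /= !omul_ob !scalerA -e1.
by rewrite (starC i (star k j)) -e2 -scalerDl de.
Qed.

Local Notation amb := (amb C).

Lemma otrE0 (a : oct) : otr a = a 0 ord0 *+ 2.
Proof. by rewrite /otr !mxE eqxx mulr2n. Qed.

Lemma otr_ob i : otr (ob i) = (i == ord0)%:R *+ 2.
Proof. by rewrite otrE0 obE eq_sym. Qed.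

Fact oend_comp_is_linear k : linear (@oend_comp F k).
Proof.
move=> c d e; apply: lfun_ob => j; rewrite add_lfunE scale_lfunE !oend_comp_ob.
by rewrite add_lfunE scale_lfunE !mxE scalerDl scalerA.
Qed.

Fact hcomp_is_linear k : linear (@hcomp F C k).
Proof.
move=> c [[d w] D] [[d' w'] D'] /=; rewrite oend_comp_is_linear.
apply: injective_projections; first apply: injective_projections => //=.
  by rewrite !ffunE linearP.
by case: ifP => //= _; rewrite scaler0 addr0.
Qed.
HB.instance Definition _ k :=
  GRing.isLinear.Build F amb amb _ (@hcomp F C k) (hcomp_is_linear k).

Lemma inO_inT d w : inO C d + inT C w = (d, w, 0) :> amb.
Proof.
rewrite inOE inTE; apply: injective_projections;
  first apply: injective_projections; by rewrite /= ?addr0 ?add0r.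
Qed.

Lemma mem_Lcomp0 D : D \in derJ C -> inJ C D \in Lcomp C ord0.
Proof. by move=> DJ; rewrite /Lcomp eqxx; apply: memv_img. Qed.

Lemma mem_Lcomp i d u : i != ord0 -> d \in Dcomp F i -> u \in J0 C ->
  (d, tens (ob i) u, 0) \in Lcomp C i.
Proof.
move=> i0 di uJ; rewrite /Lcomp (negbTE i0) -inO_inT memv_add ?memv_img //.
by rewrite -(lfunE (tens (ob i))) memv_img.
Qed.

Lemma Lcomp_sub_TC i : (Lcomp C i <= TC C)%VS.
Proof.
apply/subvP; apply: (@Lcomp_ind F C (fun _ x => x \in TC C)) => [D DJ | k d u k0 dk uJ].
  by apply: (subvP (addvSr _ _)); apply: memv_img.
apply: (subvP (addvSl _ _)); rewrite -inO_inT memv_add // memv_img //.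
  by have /mem_Dcomp[] := dk.
apply: mem_tensv => //; by rewrite mem_oct0 otr_ob (negbTE k0) mul0rn.
Qed.

Lemma TC_sum : TC C = (\sum_i Lcomp C i)%VS.
Proof.
apply/eqP; rewrite eqEsubv; apply/andP; split; last first.
  by apply/subv_sumP => i _; apply: Lcomp_sub_TC.
rewrite !subv_add -andbA; apply/and3P; split.
- apply/subvP => _ /memv_imgP[d dO ->]; rewrite (sum_oend_comp d) linear_sum.
  apply: memv_suml => k _; have dk := hom_Dcomp (oend_comp_der k dO) (@hom_oend_comp k d).
  case: (eqVneq k ord0) dk => [-> /Dcomp0-> | k0 dk]; first by rewrite linear0 mem0v.
  apply: (subvP (sumv_sup k isT (subvv _))).
  by have := mem_Lcomp k0 dk (mem0v _); rewrite linear0r /= inOE.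
- have TM : (tensv (oct0 F) (J0 C) <= \sum_(i | i != ord0) Mcomp C i)%VS.
    apply: tensv_min => a u; rewrite mem_oct0 => a0 uJ.
    rewrite (oct_sum_ob a) linear_sumlz; apply: memv_suml => i _.
    rewrite linearZl_LR /=; case: (eqVneq i ord0) => [-> | i0].
      have -> : a 0 ord0 = 0.
        by move: a0; rewrite otrE0 -mulr_natl mulf_eq0 (negbTE (natS_neq0 1)) => /eqP.
      by rewrite scale0r mem0v.
    apply/memvZ; apply: (subvP (sumv_sup i i0 (subvv _))).
    by rewrite -(lfunE (tens (ob i))) memv_img.
  apply: (subv_trans (limgS _ TM)); rewrite limg_sum; apply/subv_sumP => i i0.
  by apply: (sumv_sup i) => //; rewrite /Lcomp (negbTE i0) addvSr.
by apply: (sumv_sup ord0) => //; rewrite /Lcomp eqxx.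
Qed.

Lemma hcomp_TC x i : x \in TC C -> hcomp i x \in Lcomp C i.
Proof.
rewrite TC_sum => /memv_sumP[y yL ->]; rewrite linear_sum (bigD1 i) //=.
rewrite hcomp_id ?yL // big1 ?addr0 ?yL // => j ji.
by apply: hcomp_eq0 (yL j isT) _; rewrite eq_sym.
Qed.

Lemma sum_hcomp x : x \in TC C -> x = \sum_i hcomp i x.
Proof.
rewrite TC_sum => /memv_sumP[y yL ->]; apply: eq_bigr => i _.
rewrite linear_sum (bigD1 i) //= hcomp_id ?yL // big1 ?addr0 // => j ji.
by apply: hcomp_eq0 (yL j isT) _; rewrite eq_sym.
Qed.

(** Brackets not indexed by T vanish in both algebras, so multiplicativity is asked only on pairs of
    T. Since f intertwines the projections of degrees k and s k, injectivity on each component gives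
    injectivity on L. *)
Lemma graded_iso_glue (f : 'End(amb)) (s : 'I_8 -> 'I_8) (T T' : {set {set 'I_8}}) :
    injective s ->
    (forall i, (f @: Lcomp C i)%VS = Lcomp C (s i)) ->
    (forall i x, x \in Lcomp C i -> f x = 0 -> x = 0) ->
    (forall i j x y, [set i; j] \in T -> x \in Lcomp C i -> y \in Lcomp C j ->
       f (br x y) = br (f x) (f y)) ->
    (forall i j, ([set i; j] \in T) = ([set s i; s j] \in T')) ->
  graded_iso C T T'.
Proof.
move=> s_inj fL f_inj fbr TT'.
have fLs i x : x \in Lcomp C i -> f x \in Lcomp C (s i).
  by rewrite -fL; apply: memv_img.
have hf x k : x \in TC C -> hcomp (s k) (f x) = f (hcomp k x).
  move=> xT; rewrite {1}(sum_hcomp xT) !linear_sum (bigD1 k) //=.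
  rewrite hcomp_id ?fLs ?hcomp_TC // big1 ?addr0 // => i ik.
  by apply: (hcomp_eq0 (fLs _ _ (hcomp_TC i xT))); rewrite (inj_eq s_inj) eq_sym.
exists f; split.
- move=> x y xT yT fxy; apply/eqP; rewrite -subr_eq0; apply/eqP.
  have xyT : x - y \in TC C by rewrite rpredB.
  rewrite (sum_hcomp xyT) big1 // => i _; apply: (f_inj i); first exact: hcomp_TC.
  have fxy0 : f (x - y) = 0 by rewrite linearB /= fxy subrr.
  by rewrite -hf // fxy0 linear0.
- rewrite {1}TC_sum limg_sum TC_sum [RHS](reindex_inj s_inj).
  by apply: eq_bigr => i _; apply: fL.
- move=> x y xT yT; rewrite /brT [RHS](reindex_inj s_inj) linear_sum.
  apply: eq_bigr => i _; rewrite [RHS](reindex_inj s_inj) linear_sum.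
  apply: eq_bigr => j _; rewrite linearZ /= !hf // /eps -TT'.
  case ij: (_ \in T); last by rewrite !scale0r.
  by rewrite (fbr i j) ?hcomp_TC.
by move=> i; exists (s i).
Qed.

Local Notation R := (rmul (@jmul F C)).

Lemma br_split d w D d' w' D' :
  br ((d, w, D) : amb) (d', w', D')
  = br ((0, w, 0) : amb) (0, w', 0)
    + (comm d d', tensl d w' - tensl d' w + tensr D w' - tensr D' w, comm D D').
Proof.
rewrite /br; apply: injective_projections; first apply: injective_projections => /=.
- by rewrite linear0l add0r addrC.
- by rewrite !tens0l !tens0r !subr0 !add0r addrC.
by rewrite /= linear0l add0r addrC.
Qed.

Lemma br_JI D d a u :
  br (inJ C D) ((d, tens a u, 0) : amb) = ((0, tens a (D u), 0) : amb).
Proof.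
rewrite inJE br_split br0l add0r linear0l linear0r tens0l tensl0 tens0r tensrE.
by rewrite !subr0 add0r.
Qed.

Lemma br_IJ D d a u :
  br ((d, tens a u, 0) : amb) (inJ C D) = ((0, - tens a (D u), 0) : amb).
Proof.
rewrite inJE br_split br0r add0r linear0l linear0r tens0l tensl0 tens0r tensrE.
by rewrite !subr0 !add0r.
Qed.

Lemma br_II d d' a b u u' :
  br ((d, tens a u, 0) : amb) (d', tens b u', 0)
  = (comm d d' + (3%:R^-1 * jtr (jmul u u')) *: oD a b,
     tens (d b) u' - tens (d' a) u + tens (ocomm a b) (jstar u u'),
     (2%:R * otr (omul a b)) *: comm (R u) (R u')).
Proof.
rewrite br_split -!inTE br_tens_tens !tenslE !tens0r linear0l !subr0 addr0.
rewrite inOE inTE inJE; apply: injective_projections;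
  first apply: injective_projections; rewrite /= ?addr0 ?add0r //.
- by rewrite addrC.
by rewrite addrC.
Qed.

(** Weaker than membership in [Lcomp C (star i j)]: it concerns degrees in the ambient space only,
    and follows from the degrees of the factors in each term of the bracket. *)
Lemma br_hom i j x y : x \in Lcomp C i -> y \in Lcomp C j ->
  hcomp (star i j) (br x y) = br x y.
Proof.
move=> xi yj; move: j y yj; move: i x xi.
apply: Lcomp_ind => [D _ | i d u i0 di _]; apply: Lcomp_ind => [D' _ | j d' u' j0 dj _].
- by rewrite br_derJ starii inJE /= oend_comp0 ffunE linear0r.
- rewrite br_JI star0l /= oend_comp0 ffunE obE eqxx scale1r.
  by rewrite if_same.
- rewrite br_IJ star0 /= oend_comp0 ffunE ffunE obE eqxx scale1r linearNr.
  by rewrite if_same.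
rewrite br_II /=; set k := star i j.
have -> : oend_comp k (comm d d' + (3%:R^-1 * jtr (jmul u u')) *: oD (ob i) (ob j))
    = comm d d' + (3%:R^-1 * jtr (jmul u u')) *: oD (ob i) (ob j).
  apply: oend_comp_hom; apply: homD; first by apply: hom_comm; apply: Dcomp_hom.
  by apply/homZ/hom_oD.
have [a ->] := Dcomp_hom di j; have [b ->] := Dcomp_hom dj i.
rewrite /ocomm !omul_ob (starC j i) -/k -scalerBl !linearZl_LR /=.
rewrite !ffunE !obE eqxx !scale1r [otr _]linearZ /= otr_ob.
congr (_, _, _); first by rewrite linearD linearB /= !linearZ.
by case: (k == ord0) => //; rewrite mul0rn scaler0 mulr0 scale0r.
Qed.

Lemma oend_comp_hom0 k l d : homogeneous l d -> k != l -> oend_comp k d = 0.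
Proof.
move=> dl kl; apply: lfun_ob => j; rewrite oend_comp_ob lfunE /=.
have [c ->] := dl j; rewrite mxE obE; case: eqP => [/starIr/eqP|_].
  by rewrite (negbTE kl).
by rewrite mulr0 scale0r.
Qed.

Lemma hcomp_hcomp k l (x : amb) : k != l -> hcomp k (hcomp l x) = 0.
Proof.
case: x => [[d w] D] kl /=.
rewrite (oend_comp_hom0 (@hom_oend_comp l d) kl) ffunE obE (negbTE kl) scale0r linear0r.
by case: (eqVneq k ord0) kl => // ->; rewrite eq_sym => /negbTE->.
Qed.

(** * Signed permutations of the octonion basis and the maps they induce on L *)

Definition signed_fun (s : 'I_8 -> 'I_8) (e : 'I_8 -> bool) (a : oct) : oct :=
  \sum_i ((-1) ^+ e i * a 0 i) *: ob (s i).

Fact signed_fun_is_linear s e : linear (signed_fun s e).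
Proof.
move=> k a b; rewrite /signed_fun scaler_sumr -big_split; apply: eq_bigr => i _.
by rewrite !mxE mulrDr scalerDl scalerA mulrCA.
Qed.
HB.instance Definition _ s e :=
  GRing.isLinear.Build F oct oct _ (signed_fun s e) (signed_fun_is_linear s e).

Definition signed s e : 'End(oct) := linfun (signed_fun s e).

Lemma signed_ob s e i : signed s e (ob i) = (-1) ^+ e i *: ob (s i).
Proof.
rewrite lfunE /= /signed_fun (bigD1 i) //= obE eqxx mulr1.
by rewrite big1 ?addr0 // => j ji; rewrite obE (negbTE ji) mulr0 scale0r.
Qed.

End Grading.

Definition sign_bit (i j : 'I_8) : bool :=
  [&& i != ord0, j != ord0 & (i == j) || ~~ oct_cyclic i j].

Lemma osgnE (F : fieldType) i j : osgn F i j = (-1) ^+ sign_bit i j.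
Proof.
rewrite /osgn /sign_bit; case: (i == _) => //=; case: (j == _) => //=.
by case: (i == j) => //=; case: oct_cyclic.
Qed.

(** The condition for e_i |-> (-1)^(e i) e_(s i) to be multiplicative: s is additive on degrees and
    changes the signs of the product by the coboundary of e. *)
Definition signed_aut (s : 'I_8 -> 'I_8) (e : 'I_8 -> bool) : Prop :=
  forall i j, s (star i j) = star (s i) (s j) /\
    sign_bit (s i) (s j) = sign_bit i j (+) e i (+) e j (+) e (star i j).

Section SignedAut.

Variables (F : fieldType).
Variable C : {vspace 'rV[F]_8}.

Local Notation oct := 'rV[F]_8.
Local Notation ob := (ob F).
Local Notation amb := (amb C).
Local Notation R := (rmul (@jmul F C)).

Variables (s s' : 'I_8 -> 'I_8) (e e' : 'I_8 -> bool).
Hypotheses (sK : cancel s s') (s'K : cancel s' s) (ee' : forall i, e' (s i) = e i).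
Hypothesis se_aut : signed_aut s e.

Local Notation phi := (signed F s e).
Local Notation phi' := (signed F s' e').

Lemma phiK : (phi' \o phi)%VF = \1%VF.
Proof.
apply: lfun_ob => i; rewrite comp_lfunE id_lfunE signed_ob linearZ /= signed_ob sK ee'.
by rewrite scalerA -signr_addb addbb scale1r.
Qed.

Lemma phi'K : (phi \o phi')%VF = \1%VF.
Proof.
apply: lfun_ob => i; rewrite comp_lfunE id_lfunE signed_ob linearZ /= signed_ob s'K.
by rewrite scalerA -ee' s'K -signr_addb addbb scale1r.
Qed.

Lemma phi_mul a b : phi (omul a b) = omul (phi a) (phi b).
Proof.
pose L := lmul (@omul F); pose R' := rmul (@omul F).
have obM i j : phi (omul (ob i) (ob j)) = omul (phi (ob i)) (phi (ob j)).
  rewrite !signed_ob linearZl_LR linearZr_LR /= !omul_ob linearZ /= signed_ob.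
  have [-> se] := se_aut i j; rewrite !osgnE se !scalerA -!signr_addb.
  congr ((-1) ^+ nat_of_bool _ *: _).
  by case: (sign_bit i j); case: (e i); case: (e j); case: (e _).
have dL i : (phi \o L (ob i))%VF = (L (phi (ob i)) \o phi)%VF.
  by apply: lfun_ob => j; rewrite !comp_lfunE !lmulE obM.
have dR y : (phi \o R' y)%VF = (R' (phi y) \o phi)%VF.
  apply: lfun_ob => i; have /lfunP/(_ y) := dL i.
  by rewrite !comp_lfunE !rmulE !lmulE.
by have /lfunP/(_ a) := dR b; rewrite !comp_lfunE !rmulE.
Qed.

Lemma phiKE x : phi' (phi x) = x.
Proof. by have /lfunP/(_ x) := phiK; rewrite comp_lfunE id_lfunE. Qed.

Lemma phi'KE x : phi (phi' x) = x.
Proof. by have /lfunP/(_ x) := phi'K; rewrite comp_lfunE id_lfunE. Qed.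

Lemma s0 : s ord0 = ord0.
Proof. by have [] := se_aut ord0 ord0; rewrite !starii. Qed.

Lemma e0 : e ord0 = false.
Proof.
have [_] := se_aut ord0 ord0; rewrite s0 starii /sign_bit eqxx /=.
by case: (e ord0).
Qed.

Lemma phi_ob0 : phi (ob ord0) = ob ord0.
Proof. by rewrite signed_ob s0 e0 scale1r. Qed.

Lemma otr_phi a : otr (phi a) = otr a.
Proof.
rewrite (oct_sum_ob a) !linear_sum; apply: eq_bigr => i _.
rewrite !linearZ /= signed_ob linearZ /= !otr_ob; congr (_ *: _).
have -> : (s i == ord0) = (i == ord0) by rewrite -{1}s0 (can_eq sK).
by case: eqP => [-> | _]; rewrite ?e0 ?scale1r // mul0rn scaler0.
Qed.

Definition conj (d : 'End(oct)) : 'End(oct) := (phi \o d \o phi')%VF.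

Lemma conjE d x : conj d x = phi (d (phi' x)).
Proof. by rewrite /conj !comp_lfunE. Qed.

Lemma conj_phi d x : conj d (phi x) = phi (d x).
Proof. by rewrite conjE phiKE. Qed.

Lemma conj_comm d d' : conj (comm d d') = comm (conj d) (conj d').
Proof.
apply/lfunP => x; rewrite conjE /comm !add_lfunE !opp_lfunE !comp_lfunE.
by rewrite linearB /= !phiKE.
Qed.

Lemma conj_lmul a : conj (lmul (@omul F) a) = lmul (@omul F) (phi a).
Proof. by apply/lfunP => x; rewrite conjE !lmulE phi_mul phi'KE. Qed.

Lemma conj_rmul a : conj (rmul (@omul F) a) = rmul (@omul F) (phi a).
Proof. by apply/lfunP => x; rewrite conjE !rmulE phi_mul phi'KE. Qed.

Lemma conjD d d' : conj (d + d') = conj d + conj d'.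
Proof. by rewrite /conj comp_lfunDr comp_lfunDl. Qed.

Lemma conjZ c d : conj (c *: d) = c *: conj d.
Proof. by rewrite /conj -comp_lfunZr -comp_lfunZl. Qed.

Lemma conj_oD a b : conj (oD a b) = oD (phi a) (phi b).
Proof. by rewrite /oD (conjD (_ + _)) (conjD (comm _ _)) !conj_comm !conj_lmul !conj_rmul. Qed.

Lemma conj0 : conj 0 = 0.
Proof. by have := conjZ 0 0; rewrite !scale0r. Qed.

Lemma conj_der d : d \in derO F -> conj d \in derO F.
Proof.
move=> /mem_der dO; apply/mem_der => x y /=; rewrite !conjE.
have -> : phi' (omul x y) = omul (phi' x) (phi' y).
  by rewrite -{1}[x]phi'KE -{1}[y]phi'KE -phi_mul phiKE.
by rewrite dO /= linearD /= !phi_mul !phi'KE.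
Qed.

Lemma conj_Dcomp i d : d \in Dcomp F i -> conj d \in Dcomp F (s i).
Proof.
move=> di; apply: hom_Dcomp; first by have /mem_Dcomp[/conj_der] := di.
move=> j; rewrite conjE signed_ob linearZ /=.
have [c ->] := Dcomp_hom di (s' j); rewrite !linearZ /= signed_ob.
have [-> _] := se_aut i (s' j); rewrite s'K.
by rewrite !scalerA; eexists.
Qed.

(** The map induced by the octonion automorphism phi: conjugation on der(O), phi (x) 1 on the
    tensors, and the identity on der(J), so that L_0 is fixed pointwise. *)
Definition Phi_fun (x : amb) : amb :=
  let: (d, w, D) := x in (conj d, tensl phi w, D).

Fact Phi_fun_is_linear : linear Phi_fun.
Proof.
move=> c [[d w] D] [[d' w'] D'] /=; rewrite conjD conjZ.
apply: injective_projections; first apply: injective_projections => //=.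
  by rewrite linearP.
by [].
Qed.
HB.instance Definition _ :=
  GRing.isLinear.Build F amb amb _ Phi_fun Phi_fun_is_linear.

Definition Phi : 'End(amb) := linfun Phi_fun.

Lemma PhiJ D : Phi (inJ C D) = inJ C D.
Proof. by rewrite inJE lfunE /= conj0 tensl0. Qed.

Lemma PhiI d a u : Phi (d, tens a u, 0) = (conj d, tens (phi a) u, 0) :> amb.
Proof. by rewrite lfunE /= tenslE. Qed.

Lemma Phi_br i j x y : x \in Lcomp C i -> y \in Lcomp C j ->
  Phi (br x y) = br (Phi x) (Phi y).
Proof.
move=> xi yj; move: j y yj; move: i x xi.
apply: Lcomp_ind => [D _ | i d u i0 di _]; apply: Lcomp_ind => [D' _ | j d' u' j0 dj _].
- by rewrite br_derJ !PhiJ br_derJ.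
- by rewrite br_JI PhiJ !PhiI br_JI conj0.
- by rewrite br_IJ PhiJ !PhiI br_IJ -linearN PhiI conj0 linearN.
rewrite br_II !PhiI br_II !conj_phi lfunE /= conjD conjZ conj_comm conj_oD.
congr (_, _, _); last by rewrite -phi_mul otr_phi.
by rewrite linearD linearB /= !tenslE /ocomm (linearB phi) /= !phi_mul.
Qed.

Lemma Phi_Lcomp i x : x \in Lcomp C i -> Phi x \in Lcomp C (s i).
Proof.
move: i x; apply: Lcomp_ind => [D DJ | i d u i0 di uJ].
  by rewrite PhiJ s0; apply: mem_Lcomp0.
(* The sign is moved from the octonion to the Jordan factor, to reach the shape required by
   [mem_Lcomp]. *)
rewrite PhiI signed_ob linearZl_LR -linearZr_LR /=.
apply: mem_Lcomp; rewrite ?memvZ ?conj_Dcomp //.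
by rewrite -s0 (can_eq sK).
Qed.

End SignedAut.

Section Isomorphisms.

Variables (F : fieldType).
Variable C : {vspace 'rV[F]_8}.

Local Notation oct := 'rV[F]_8.
Local Notation ob := (ob F).
Local Notation amb := (amb C).

Variables (s s' : 'I_8 -> 'I_8) (e e' : 'I_8 -> bool).
Hypotheses (sK : cancel s s') (s'K : cancel s' s) (ee' : forall i, e' (s i) = e i).
Hypothesis se_aut : signed_aut s e.

Lemma signed_aut_inv : signed_aut s' e'.
Proof.
move=> i j; have [sm se] := se_aut (s' i) (s' j).
rewrite !s'K in sm se; have ei k : e' k = e (s' k) by rewrite -ee' s'K.
have sm' : s' (star i j) = star (s' i) (s' j) by rewrite -sm sK.
split=> //; rewrite !ei sm' se.
by case: (sign_bit _ _); case: (e _); case: (e _); case: (e _).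
Qed.

Lemma e'e i : e (s' i) = e' i.
Proof. by rewrite -ee' s'K. Qed.

Lemma Phi_inv x : Phi C s s' e e' (Phi C s' s e' e x) = x.
Proof.
case: x => [[d w] D]; rewrite !lfunE /= /conj.
have K := phi'K F s'K ee'.
congr (_, _, _).
  apply/lfunP => x; rewrite !comp_lfunE.
  by rewrite !(phi'KE s'K ee').
rewrite [w]tens_sum !linear_sum; apply: eq_bigr => i _ /=.
by rewrite !tenslE (phi'KE s'K ee') -tens_sum.
Qed.

Lemma Phi_img i : (Phi C s s' e e' @: Lcomp C i)%VS = Lcomp C (s i).
Proof.
apply/eqP; rewrite eqEsubv; apply/andP; split; apply/subvP => x.
  by case/memv_imgP=> y yL ->; apply: Phi_Lcomp.
move=> xL; rewrite -(Phi_inv x); apply: memv_img; rewrite -[i]sK.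
by apply: Phi_Lcomp xL; [exact: s'K | exact: sK | exact: e'e | exact: signed_aut_inv].
Qed.

End Isomorphisms.

Section GradedIso.

Variables (F : fieldType).
Hypothesis charF0 : [pchar F] =i pred0.
Variable C : {vspace 'rV[F]_8}.

Local Notation oct := 'rV[F]_8.
Local Notation ob := (ob F).
Local Notation amb := (amb C).

Variables (s s' : 'I_8 -> 'I_8) (e e' : 'I_8 -> bool).
Hypotheses (sK : cancel s s') (s'K : cancel s' s) (ee' : forall i, e' (s i) = e i).
Hypothesis se_aut : signed_aut s e.

Lemma Phi_inj x : Phi C s s' e e' x = 0 -> x = 0.
Proof.
move=> x0; rewrite -(Phi_inv sK (e'e s'K ee') x).
by rewrite x0 linear0.
Qed.

Lemma signed_iso (T T' : {set {set 'I_8}}) :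
    (forall i j, ([set i; j] \in T) = ([set s i; s j] \in T')) ->
  graded_iso C T T'.
Proof.
apply: (@graded_iso_glue _ charF0 C (Phi C s s' e e') s T T').
- exact: can_inj sK.
- by move=> i; apply: Phi_img.
- by move=> _ x _; apply: Phi_inj.
by move=> i j x y _; apply: Phi_br.
Qed.

End GradedIso.

(* The signs are determined by e_5 = e_1 e_2, e_6 = e_1 e_3, e_7 = e_5 e_6 and
   e_4 = e_1 e_7. *)
Definition aut_sign (s : 'I_8 -> 'I_8) : 'I_8 -> bool :=
  let sb a b := sign_bit (s (ix a)) (s (ix b)) in
  let e5 := sb 1 2 in let e6 := sb 1 3 in
  let e7 := e5 (+) e6 (+) sb 5 6 in let e4 := e7 (+) sb 1 7 in
  fun i => nth false [:: false; false; false; false; e4; e5; e6; e7] i.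

Definition signed_autb (s : 'I_8 -> 'I_8) (e : 'I_8 -> bool) : bool :=
  all (fun i => all (fun j => (s (star i j) == star (s i) (s j)) &&
    (sign_bit (s i) (s j) == sign_bit i j (+) e i (+) e j (+) e (star i j))) I8) I8.

Lemma signed_autP s e : signed_autb s e -> signed_aut s e.
Proof.
move=> /all_I8P h i j; have /all_I8P/(_ j)/andP[/eqP ? /eqP ?] := h i.
by split.
Qed.

Lemma collineations_aut :
  all (fun q => uniq [seq perm_of q i | i <- I8]
                && signed_autb (perm_of q) (aut_sign (perm_of q))) collineations.
Proof. by vm_compute. Qed.

Lemma uniq_I8_inj (s : 'I_8 -> 'I_8) : uniq [seq s i | i <- I8] -> injective s.
Proof.
move=> u i j; exact: (uniq_map_inj_in u (mem_I8 i) (mem_I8 j)).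
Qed.

(** The linearised flexible law on basis elements. [l_i, r_j] e_k is minus the associator (e_i, e_k,
    e_j); for it to change sign under the exchange of i and j, either both associators vanish or
    their terms match crosswise. *)
Lemma oD_sign_comp :
  all (fun i => all (fun j => all (fun k =>
     let a i j := sign_bit k j (+) sign_bit i (star k j) in
     let b i j := sign_bit i k (+) sign_bit (star i k) j in
     (a i j == b i j) && (a j i == b j i) || (a i j == b j i) && (a j i == b i j))
   I8) I8) I8.
Proof. by vm_compute. Qed.

(** * Collineations and the exchange of L_2 and L_5 as graded isomorphisms *)

Section Swap.

Variables (F : fieldType).
Hypothesis charF0 : [pchar F] =i pred0.
Variable C : {vspace 'rV[F]_8}.

Local Notation oct := 'rV[F]_8.
Local Notation ob := (ob F).
Local Notation amb := (amb C).

Lemma collineation_iso q T : q \in collineations ->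
  graded_iso C (pullback (perm_of q) T) T /\ graded_iso C T (pullback (perm_of q) T).
Proof.
move=> /(allP collineations_aut)/andP[/uniq_I8_inj s_inj /signed_autP aut].
set s := perm_of q in s_inj aut *; set e := aut_sign s in aut.
have sK : cancel s (invF s_inj) by apply: invF_f.
have s'K : cancel (invF s_inj) s by apply: f_invF.
have eE i : (e \o invF s_inj) (s i) = e i by rewrite /= sK.
split; first by apply: (signed_iso charF0 C sK s'K eE aut) => i j; rewrite mem_pullback.
apply: (signed_iso charF0 C s'K sK _ (signed_aut_inv sK s'K eE aut)) => // i j.
by rewrite mem_pullback !s'K.
Qed.

Lemma commC (V : vectType F) (f g : 'End(V)) : comm f g = - comm g f.
Proof. by rewrite /comm opprB. Qed.

Lemma commE (V : vectType F) (f h : 'End(V)) x : comm f h x = f (h x) - h (f x).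
Proof. by rewrite /comm add_lfunE opp_lfunE !comp_lfunE. Qed.

Lemma comm_lmul_rmul_ob i j k :
  comm (lmul (@omul F) (ob i)) (rmul (@omul F) (ob j)) (ob k)
  = ((-1) ^+ (sign_bit k j (+) sign_bit i (star k j))
     - (-1) ^+ (sign_bit i k (+) sign_bit (star i k) j)) *: ob (star (star i k) j).
Proof.
rewrite commE lmulE rmulE lmulE rmulE /= (omul_ob _ k) (omul_ob _ i k).
rewrite linearZr_LR linearZl_LR /= (omul_ob _ i) (omul_ob _ (star i k)).
by rewrite !scalerA starA -scalerBl !osgnE -!signr_addb.
Qed.

Lemma oD_anti i j : oD (ob i) (ob j) = - oD (ob j) (ob i).
Proof.
pose l := lmul (@omul F); pose r := rmul (@omul F).
suff lr : comm (l (ob i)) (r (ob j)) = - comm (l (ob j)) (r (ob i)).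
  by rewrite /oD -/l -/r (commC (l _) (l _)) (commC (r _) (r _)) lr !opprD.
apply: lfun_ob => k; rewrite opp_lfunE !comm_lmul_rmul_ob -scaleNr opprB.
have e : star (star j k) i = star (star i k) j.
  by rewrite (starC j) (starC _ i) starA.
rewrite [X in _ = _ *: ob X]e.
have /all_I8P/(_ j)/all_I8P/(_ k) := (all_I8P _ oD_sign_comp) i.
by case/orP=> /andP[/eqP-> /eqP->]; rewrite ?subrr.
Qed.

Lemma oD_self i : oD (ob i) (ob i) = 0.
Proof.
apply/eqP; have /eqP := oD_anti i i.
rewrite -subr_eq0 opprK -mulr2n -scaler_nat scaler_eq0.
by rewrite (negbTE (natS_neq0 charF0 1)).
Qed.

Lemma der_comm (A : vectType F) (m : {bilinear A -> A -> A}) d d' :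
  d \in der m -> d' \in der m -> comm d d' \in der m.
Proof.
move=> /mem_der dm /mem_der d'm; apply/mem_der => x y.
rewrite /comm !add_lfunE !opp_lfunE !comp_lfunE d'm dm !linearD /= !dm !d'm.
rewrite linearBl linearNr /= !opprD.
by rewrite (AC ((2*2)*(2*2)) (((1*5)*(4*8))*((2*7)*(3*6)))) /= !subrr !addr0.
Qed.

(* On each plane <e_j, e_1 e_j> this automorphism is 1, -1 or multiplication by
   e_1 up to sign, so that it commutes with the derivations of degree g_1, which
   kill e_1. *)
Definition rot : 'I_8 -> 'I_8 := perm_of (collineation (ix 1) (ix 5) (ix 3)).
Definition rot_sign : 'I_8 -> bool := aut_sign rot.

Lemma rotK : involutive rot.
Proof.
have: all (fun i => rot (rot i) == i) I8 by vm_compute.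
by move=> /all_I8P h i; apply/eqP/h.
Qed.

Lemma rot_aut : signed_aut rot rot_sign.
Proof. by apply: signed_autP; vm_compute. Qed.

Lemma rot_line j : [|| j == ord0, j == ix 1,
   (rot j == j) && (rot_sign (star (ix 1) j) == rot_sign j) |
   (rot j == star (ix 1) j) && (rot_sign (star (ix 1) j) == ~~ rot_sign j)].
Proof.
move: j; apply/all_I8P.
by vm_compute.
Qed.

Local Notation phi := (signed F rot rot_sign).
Local Notation Phi := (Phi C rot rot rot_sign (rot_sign \o rot)).

Let rot_signK i : (rot_sign \o rot) (rot i) = rot_sign i.
Proof. by rewrite /= rotK. Qed.

Lemma phi_fix j : rot j == j -> ~~ rot_sign j -> phi (ob j) = ob j.
Proof. by move=> /eqP rj ej; rewrite signed_ob rj (negbTE ej) scale1r. Qed.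

Lemma phi1 : phi (ob (ix 1)) = ob (ix 1).
Proof. by apply: phi_fix; vm_compute. Qed.

(** As d kills e_1, it commutes with left multiplication by e_1, whose square is -1. *)
Lemma derO_ob_line d j c : d \in Dcomp F (ix 1) ->
    d (ob j) = c *: ob (star (ix 1) j) -> j != ord0 -> j != ix 1 ->
  d (ob (star (ix 1) j)) = - c *: ob j.
Proof.
move=> d1 dj j0 j1; have [/mem_der dO _] := (mem_Dcomp (ix 1) d).1 d1.
have := dO (ob (ix 1)) (ob j); rewrite /= (Dcomp_self charF0 _ d1) //.
rewrite linear0l add0r dj linearZr_LR /= !omul_ob linearZ /= starKl scalerA.
have -> : osgn F (ix 1) (star (ix 1) j) = - osgn F (ix 1) j.
  rewrite !osgnE; have -> : sign_bit (ix 1) (star (ix 1) j) = ~~ sign_bit (ix 1) j.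
    have: all (fun j => (j != ord0) ==> (j != ix 1) ==>
       (sign_bit (ix 1) (star (ix 1) j) == ~~ sign_bit (ix 1) j)) I8 by vm_compute.
    by move=> /all_I8P/(_ j); rewrite j0 j1 => /eqP.
  by rewrite signrN.
rewrite osgnE => /(congr1 (fun a => (-1) ^+ sign_bit (ix 1) j *: a)).
by rewrite !scalerA !mulrN mulrCA -!signr_addb addbb mulr1 scale1r.
Qed.

Lemma conj_rot d : d \in Dcomp F (ix 1) ->
  conj rot rot rot_sign (rot_sign \o rot) d = d.
Proof.
move=> d1; have [dO _] := (mem_Dcomp (ix 1) d).1 d1.
have d_phi : (phi \o d)%VF = (d \o phi)%VF.
  apply: lfun_ob => j; rewrite !comp_lfunE.
  have [c dj] := Dcomp_hom d1 j.
  case: (eqVneq j ord0) => [-> | j0].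
    by rewrite (phi_ob0 F rot_aut) (derO_ob0 dO) linear0.
  case: (eqVneq j (ix 1)) => [-> | j1].
    by rewrite phi1 (Dcomp_self charF0 _ d1) // linear0.
  have := rot_line j; rewrite (negbTE j0) (negbTE j1) /= dj signed_ob linearZ /=.
  have rj : rot (star (ix 1) j) = star (ix 1) (rot j).
    have r1 : rot (ix 1) = ix 1 by apply/eqP; vm_compute.
    by have [-> _] := rot_aut (ix 1) j; rewrite r1.
  rewrite signed_ob rj linearZ /=.
  rewrite [d _]linearZ /=.
  case/orP=> /andP[/eqP-> /eqP->]; first by rewrite dj.
  (* The remaining planes are those where phi exchanges the two axes: its sign and the coefficient
     of d both change between e_j and e_{1*j}, so the changes cancel. *)
  rewrite starKl (derO_ob_line d1 dj) // signrN !scalerA.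
  by rewrite mulrN mulNr mulrC.
apply/lfunP => x; rewrite conjE.
have /lfunP/(_ (signed F rot (rot_sign \o rot) x)) := d_phi.
rewrite !comp_lfunE => ->; congr (d _).
exact: (phi'KE rotK rot_signK).
Qed.

Lemma Phi_fixed i x : i \in [:: ix 0; ix 1] -> x \in Lcomp C i -> Phi x = x.
Proof.
move=> + xi; move: i x xi.
apply: Lcomp_ind => [D _ _ | i d u i0 di _]; first by rewrite PhiJ.
rewrite !inE ix0 (negbTE i0) /= => /eqP i1; rewrite i1 in di *.
by rewrite PhiI phi1 conj_rot.
Qed.

Lemma LcompI i x : i != ord0 -> x \in Lcomp C i ->
  exists d u, [/\ d \in Dcomp F i, u \in J0 C & x = (d, tens (ob i) u, 0)].
Proof.
move=> + xi; move: i x xi; apply: Lcomp_ind => [D _ // | i d u _ di uJ _].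
by exists d, u.
Qed.

(** For i nonzero only the der(J) part of the bracket survives: [d, d'] is a derivation of degree 0,
    D_{a,a} and [a, a] vanish, and d, d' kill e_i. *)
Lemma Phi_br_self i x y : x \in Lcomp C i -> y \in Lcomp C i ->
  Phi (br x y) = br x y.
Proof.
case: (eqVneq i ord0) => [-> | i0] xi yi.
  rewrite (Phi_br rotK rotK rot_signK rot_aut xi yi).
  by rewrite !(@Phi_fixed ord0) // inE ix0 eqxx.
have [d [u [di _ ->]]] := LcompI i0 xi; have [d' [u' [di' _ ->]]] := LcompI i0 yi.
rewrite br_II !(Dcomp_self charF0 i0) // oD_self // scaler0 addr0.
have -> : comm d d' = 0.
  apply: (Dcomp0 charF0); apply: hom_Dcomp.
    by apply: der_comm; [have /mem_Dcomp[] := di | have /mem_Dcomp[] := di'].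
  by rewrite -(starii i); apply: hom_comm; apply: Dcomp_hom.
rewrite /ocomm subrr !linear0l subrr addr0.
by rewrite -inJE PhiJ.
Qed.

(** [Phi_fixed] would need the bracket to lie in L_1, so the three parts are treated separately.
    [d, d'] is a derivation of degree g_1, fixed by [conj_rot]; D_{e_i,e_j} goes to -D_{e_j,e_i}
    because exactly one of the two signs is negative; the tensor part is a multiple of e_1. *)
Lemma Phi_br_swapped i j x y : i != ord0 -> j != ord0 -> star i j = ix 1 ->
    rot i = j -> rot j = i -> rot_sign i (+) rot_sign j ->
    x \in Lcomp C i -> y \in Lcomp C j ->
  Phi (br x y) = br x y.
Proof.
move=> i0 j0 ij ri rj eij.
move=> /(LcompI i0)[d [u [di _ ->]]] /(LcompI j0)[d' [u' [dj _ ->]]].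
rewrite br_II.
have [a ->] := Dcomp_hom di j; have [b ->] := Dcomp_hom dj i.
rewrite /ocomm !omul_ob (starC j) ij -scalerBl [otr _]linearZ /= otr_ob.
rewrite [ix 1 == ord0]/= mul0rn scaler0 mulr0 scale0r lfunE /=.
congr (_, _, _).
  rewrite conjD conjZ (conj_oD rotK rotK rot_signK rot_aut) conj_rot; last first.
    rewrite -ij; apply: hom_Dcomp; last by apply: hom_comm; apply: Dcomp_hom.
    by apply: der_comm; [have /mem_Dcomp[] := di | have /mem_Dcomp[] := dj].
  rewrite !signed_ob ri rj linearZl_LR linearZr_LR /= scalerA -signr_addb eij.
  by rewrite expr1 scaleN1r -oD_anti.
rewrite linearD linearB /= !tenslE.
have phiZ c : phi (c *: ob (ix 1)) = c *: ob (ix 1) by rewrite linearZ /= phi1.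
by rewrite !phiZ.
Qed.

(** Written with the projections of degrees 2 and 5 because [graded_iso] asks for a linear map of
    the whole ambient space. *)
Definition swap_map : 'End(amb) :=
  (\1 + ((Phi - \1) \o (linfun (@hcomp F C (ix 2)) + linfun (@hcomp F C (ix 5)))))%VF.

(** Homogeneity in the ambient space is assumed instead of membership in a component, so that the
    lemma applies to brackets through [br_hom]. *)
Lemma swap_mapE i x : hcomp i x = x -> swap_map x = if off_swap i then x else Phi x.
Proof.
move=> xi; have h k : hcomp k x = if k == i then x else 0.
  by case: eqP => [-> // | /eqP ki]; rewrite -xi hcomp_hcomp.
rewrite /swap_map add_lfunE id_lfunE comp_lfunE !add_lfunE opp_lfunE id_lfunE.
rewrite !(lfunE (@hcomp F C _)) /= !h /off_swap !inE !(eq_sym i).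
case: eqP => [<- | _] /=.
  by rewrite addr0 addrC subrK.
by case: eqP => _ /=; rewrite add0r ?linear0 ?subr0 ?addr0 // addrC subrK.
Qed.

Lemma swap_mapL i x : x \in Lcomp C i ->
  swap_map x = if off_swap i then x else Phi x.
Proof. by move=> xi; apply: swap_mapE; apply: hcomp_id. Qed.

Lemma near_line_off i : near_line i -> off_swap i -> i \in [:: ix 0; ix 1].
Proof.
by rewrite /near_line /off_swap !inE negb_or orbA => /orP[// | /orP[] ->]; rewrite ?andbF.
Qed.

Lemma near_cases i j : near_line i -> near_line j -> off_swap (star i j) ->
  [|| i == j, (i \in [:: ix 0; ix 1]) && (j \in [:: ix 0; ix 1]),
      (i == ix 2) && (j == ix 5) | (i == ix 5) && (j == ix 2)].
Proof.
move: i j; suff H : all (fun i => all (fun j =>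
    near_line i ==> near_line j ==> off_swap (star i j) ==>
    [|| i == j, (i \in [:: ix 0; ix 1]) && (j \in [:: ix 0; ix 1]),
        (i == ix 2) && (j == ix 5) | (i == ix 5) && (j == ix 2)]) I8) I8.
  by move=> i j ni nj ok; move/all_I8P/(_ i)/all_I8P/(_ j): H; rewrite ni nj ok.
by vm_compute.
Qed.

Lemma swap25E i : swap25 i == if off_swap i then i else rot i.
Proof. by move: i; apply/all_I8P; vm_compute. Qed.

Lemma swap_map_near i x : near_line i -> x \in Lcomp C i -> swap_map x = Phi x.
Proof.
move=> ni xi; rewrite (swap_mapL xi); case: ifP => // oi.
by rewrite (Phi_fixed (near_line_off ni oi) xi).
Qed.

Lemma swap_iso (T : {set {set 'I_8}}) :
    (forall i j, [set i; j] \in T -> swap_ok i j) ->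
  graded_iso C T (pullback swap25 T).
Proof.
move=> T_ok; apply: (@graded_iso_glue F charF0 C swap_map swap25).
- exact: inv_inj swap25K.
- move=> i; have /eqP -> := swap25E i; case oi : (off_swap i).
    rewrite (@eq_in_limg _ _ _ _ swap_map \1%VF) ?lim1g // => x xi.
    by rewrite (swap_mapL xi) oi id_lfunE.
  rewrite (@eq_in_limg _ _ _ _ swap_map Phi) => [|x xi].
    exact: (Phi_img C rotK rotK rot_signK rot_aut).
  by rewrite (swap_mapL xi) oi.
- move=> i x xi; rewrite (swap_mapL xi); case: ifP => // _.
  exact: (Phi_inj rotK rotK rot_signK).
- move=> i j x y ij xi yj; have z_hom := br_hom xi yj.
  have := T_ok _ _ ij; case/orP=> /and4P[ni nj nk _]; last first.
    by rewrite (swap_mapL xi) (swap_mapL yj) (swap_mapE z_hom) ni nj nk.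
  (* On {0,1,2,5} the map agrees with the automorphism [Phi], except possibly on the bracket itself
     when its degree is 0 or 1; there [Phi] must be shown to fix it. *)
  rewrite (swap_map_near ni xi) (swap_map_near nj yj) (swap_mapE z_hom).
  rewrite -(Phi_br rotK rotK rot_signK rot_aut xi yj); case: ifP => // ok.
  case: (or4P (near_cases ni nj ok)) => [/eqP e | /andP[i01 j01] | |].
  - by rewrite e in xi *; rewrite (Phi_br_self xi yj).
  - by rewrite (Phi_br rotK rotK rot_signK rot_aut xi yj) (Phi_fixed i01 xi) (Phi_fixed j01 yj).
  - move=> /andP[/eqP ei /eqP ej]; rewrite ei ej in xi yj *.
    by rewrite (@Phi_br_swapped (ix 2) (ix 5)) //; try (apply/eqP; vm_compute).
  move=> /andP[/eqP ei /eqP ej]; rewrite ei ej in xi yj *.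
  by rewrite (@Phi_br_swapped (ix 5) (ix 2)) //; try (apply/eqP; vm_compute).
by move=> i j; rewrite mem_pullback !swap25K.
Qed.

End Swap.

(** * Nonzero brackets of homogeneous components *)

Section ScalarMatrices.

Variables (F : fieldType).

Local Notation mat3 := {ffun 'I_3 * 'I_3 -> 'rV[F]_8}.

Definition scalar_mat (A : 'M[F]_3) : mat3 := [ffun p => A p.1 p.2 *: ob F ord0].

Lemma mmul_scalarl A (u : mat3) :
  mmul (scalar_mat A) u = [ffun p => \sum_k A p.1 k *: u (k, p.2)].
Proof.
apply/ffunP => p; rewrite !ffunE; apply: eq_bigr => k _.
by rewrite ffunE linearZl_LR /= omul1.
Qed.

Lemma mmul_scalarr A (u : mat3) :
  mmul u (scalar_mat A) = [ffun p => \sum_k A k p.2 *: u (p.1, k)].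
Proof.
apply/ffunP => p; rewrite !ffunE; apply: eq_bigr => k _.
by rewrite ffunE linearZr_LR /= omulr1.
Qed.

Lemma mmul_scalar A B : mmul (scalar_mat A) (scalar_mat B) = scalar_mat (A *m B).
Proof.
rewrite mmul_scalarl; apply/ffunP => p; rewrite !ffunE mxE scaler_suml.
by apply: eq_bigr => k _; rewrite ffunE scalerA.
Qed.

(** The entries of a scalar matrix lie in the nucleus of the octonions; this and the next two lemmas
    place it in each of the three positions of an associative product. *)
Lemma mmulA_scalarl A (u v : mat3) :
  mmul (scalar_mat A) (mmul u v) = mmul (mmul (scalar_mat A) u) v.
Proof.
rewrite !mmul_scalarl; apply/ffunP => p; rewrite !ffunE.
under eq_bigr => k _ do rewrite ffunE scaler_sumr.
rewrite exchange_big; apply: eq_bigr => l _; rewrite ffunE linear_sumlz.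
by apply: eq_bigr => k _; rewrite linearZl_LR.
Qed.

Lemma mmulA_scalarr A (u v : mat3) :
  mmul (mmul u v) (scalar_mat A) = mmul u (mmul v (scalar_mat A)).
Proof.
rewrite !mmul_scalarr; apply/ffunP => p; rewrite !ffunE.
under eq_bigr => k _ do rewrite ffunE scaler_sumr.
rewrite exchange_big; apply: eq_bigr => l _; rewrite ffunE linear_sumr.
by apply: eq_bigr => k _; rewrite linearZr_LR.
Qed.

Lemma mmulA_scalar A (u v : mat3) :
  mmul (mmul u (scalar_mat A)) v = mmul u (mmul (scalar_mat A) v).
Proof.
rewrite mmul_scalarl mmul_scalarr; apply/ffunP => p; rewrite !ffunE.
under eq_bigr => k _ do rewrite ffunE linear_sumlz.
under [RHS]eq_bigr => k _ do rewrite ffunE linear_sumr.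
rewrite exchange_big; apply: eq_bigr => l _; apply: eq_bigr => k _.
by rewrite linearZl_LR linearZr_LR.
Qed.

Lemma mstar_scalar A : mstar (scalar_mat A) = scalar_mat A^T.
Proof. by apply/ffunP => p; rewrite !ffunE linearZ /= oconj_ob eqxx mxE. Qed.

Lemma mtr_scalar A : mtr (scalar_mat A) = \tr A.
Proof. by apply: eq_bigr => i _; rewrite ffunE mxE obE eqxx mulr1. Qed.

Lemma scalar_mat_inj : injective scalar_mat.
Proof.
move=> A B /ffunP e; apply/matrixP => i j.
by have /rowP/(_ ord0) := e (i, j); rewrite !ffunE !mxE eqxx !mulr1.
Qed.

Fact scalar_mat_is_linear : linear scalar_mat.
Proof. by move=> k A B; apply/ffunP => p; rewrite !ffunE !mxE scalerDl scalerA. Qed.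
HB.instance Definition _ :=
  GRing.isLinear.Build F 'M[F]_3 mat3 _ scalar_mat scalar_mat_is_linear.

Definition mad (A : 'M[F]_3) (u : mat3) : mat3 :=
  mmul (scalar_mat A) u - mmul u (scalar_mat A).

Fact mad_is_linear A : linear (mad A).
Proof.
move=> k u v; rewrite /mad linearPl linearPr /= scalerBr opprD.
by rewrite addrACA.
Qed.
HB.instance Definition _ A :=
  GRing.isLinear.Build F mat3 mat3 _ (mad A) (mad_is_linear A).

Lemma mad_mul A u v : mad A (mmul u v) = mmul (mad A u) v + mmul u (mad A v).
Proof.
rewrite /mad linearBl linearBr /= mmulA_scalarl mmulA_scalarr mmulA_scalar.
by rewrite addrA subrK.
Qed.

Lemma mad_scalar A B : mad A (scalar_mat B) = scalar_mat (A *m B - B *m A).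
Proof. by rewrite /mad !mmul_scalar linearB. Qed.

Variable C : {vspace 'rV[F]_8}.
Hypothesis hC : C \in hurwitz F.

Local Notation J := (J C).
Local Notation R := (rmul (@jmul F C)).

Definition jscalar (A : 'M[F]_3) : J := vsproj (herm C) (scalar_mat A).

Lemma jscalarK A : A^T = A -> vsval (jscalar A) = scalar_mat A.
Proof.
move=> AT; rewrite vsprojK //; apply/mem_herm; rewrite mstar_scalar AT; split=> // i j.
by rewrite ffunE memvZ // hurwitz1.
Qed.

Lemma jtr_jscalar A : A^T = A -> jtr (jscalar A) = \tr A.
Proof. by move=> AT; rewrite /jtr jscalarK // mtr_scalar. Qed.

Lemma jmul_jscalar A B : A^T = A -> B^T = B ->
  jmul (jscalar A) (jscalar B) = jscalar (2%:R^-1 *: (A *m B + B *m A)).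
Proof.
move=> AT BT; apply: val_inj; rewrite /= jmulE // !jscalarK //; last first.
  by rewrite linearZ linearD /= !trmx_mul AT BT addrC.
by rewrite !mmul_scalar -linearD -linearZ.
Qed.

Definition jad A B : 'End(J) := comm (R (jscalar A)) (R (jscalar B)).

Lemma rmul_jscalar A w : A^T = A -> vsval (R (jscalar A) w)
  = 2%:R^-1 *: (mmul (vsval w) (scalar_mat A) + mmul (scalar_mat A) (vsval w)).
Proof. by move=> AT; rewrite rmulE /= jmulE // jscalarK. Qed.

Lemma vsvalB (x y : J) : vsval (x - y) = vsval x - vsval y.
Proof. exact: linearB. Qed.

(** [R_A, R_B] is a quarter of the commutator with [A, B], as in a special Jordan algebra, because
    scalar matrices associate with everything. The commutator form makes it a derivation. *)
Lemma jadE A B w : A^T = A -> B^T = B ->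
  vsval (jad A B w) = (2%:R^-1 * 2%:R^-1) *: mad (A *m B - B *m A) (vsval w).
Proof.
move=> AT BT; rewrite /jad commE vsvalB.
rewrite (rmul_jscalar _ AT) (rmul_jscalar _ BT) (rmul_jscalar _ BT) (rmul_jscalar _ AT).
rewrite !linearZl_LR !linearZr_LR /= -!scalerDr -!scalerBr scalerA; congr (_ *: _).
rewrite /mad [scalar_mat (_ - _)]linearB /= -!mmul_scalar linearBl linearBr /=.
rewrite !linearDl !linearDr /= !mmulA_scalarl !mmulA_scalarr !mmulA_scalar.
rewrite !opprD opprK.
by rewrite (AC ((2*2)*(2*2)) (((4*8)*(5*1))*((2*7)*(3*6)))) /= !subrr !addr0.
Qed.

Lemma jad_der A B : A^T = A -> B^T = B -> jad A B \in derJ C.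
Proof.
move=> AT BT; apply/mem_der => u v /=; apply: val_inj; rewrite /= jadE // !jmulE //.
rewrite !jadE // linearZ linearD /= !mad_mul !linearZl_LR !linearZr_LR /=.
rewrite -!scalerDr !scalerA; congr (_ *: _); first exact: mulrC.
by rewrite (AC (2*2) ((1*4)*(2*3))).
Qed.

Lemma comm_jad_jscalar A B A' B' S :
    A^T = A -> B^T = B -> A'^T = A' -> B'^T = B' -> S^T = S ->
  let K := A *m B - B *m A in let K' := A' *m B' - B' *m A' in
  let c := 2%:R^-1 * 2%:R^-1 in
  vsval (comm (jad A B) (jad A' B') (jscalar S))
  = c *: (c *: scalar_mat ((K *m (K' *m S - S *m K') - (K' *m S - S *m K') *m K)
                    - (K' *m (K *m S - S *m K) - (K *m S - S *m K) *m K'))).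
Proof.
move=> AT BT AT' BT' ST /=.
rewrite commE vsvalB (jadE _ AT BT) (jadE _ AT' BT') (jadE _ AT' BT') (jadE _ AT BT).
by rewrite (jscalarK ST) !linearZ /= !mad_scalar -!scalerDr -linearB.
Qed.

(** Products and differences are carried out on integer tables, where they compute; characteristic
    zero then keeps a non-zero entry non-zero in F. *)
Definition int_mx (t : seq (seq int)) : 'M[F]_3 :=
  \matrix_(i, j) (nth 0 (nth [::] t i) j)%:~R.

Definition table_mul (t t' : seq (seq int)) : seq (seq int) :=
  let m i j k := nth 0 (nth [::] t i) k * nth 0 (nth [::] t' k) j in
  mkseq (fun i => mkseq (fun j => m i j 0%N + m i j 1%N + m i j 2%N) 3) 3.

Definition table_sub (t t' : seq (seq int)) : seq (seq int) :=
  mkseq (fun i => mkseq (fun j =>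
    nth 0 (nth [::] t i) j - nth 0 (nth [::] t' i) j) 3) 3.

Lemma int_mx_mul t t' : int_mx t *m int_mx t' = int_mx (table_mul t t').
Proof.
apply/matrixP => i j; rewrite !mxE !big_ord_recr big_ord0 /= !mxE.
by rewrite add0r /table_mul !nth_mkseq // !rmorphD !rmorphM.
Qed.

Lemma int_mx_sub t t' : int_mx t - int_mx t' = int_mx (table_sub t t').
Proof.
by apply/matrixP => i j; rewrite !mxE /table_sub !nth_mkseq // rmorphB.
Qed.

Hypothesis charF0 : [pchar F] =i pred0.

Local Notation oct := 'rV[F]_8.
Local Notation ob := (ob F).
Local Notation amb := (amb C).

Lemma intF_eq0 (z : int) : (z%:~R == 0 :> F) = (z == 0).
Proof.
have nat0 n : (n%:R == 0 :> F) = (n == 0%N) by have [/(_ charF0) ->] := pcharf0P F.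
by case: z => n; rewrite ?NegzE ?rmorphN ?oppr_eq0 /= -pmulrn nat0.
Qed.

Lemma int_mx_neq0 t i j : (i < 3)%N -> (j < 3)%N ->
  nth 0 (nth [::] t i) j != 0 -> int_mx t != 0.
Proof.
move=> i3 j3; apply: contra => /eqP/matrixP/(_ (Ordinal i3) (Ordinal j3))/eqP.
by rewrite !mxE intF_eq0.
Qed.

Lemma scalar_mat_neq0 A : A != 0 -> scalar_mat A != 0.
Proof. by apply: contra => /eqP e; apply/eqP/scalar_mat_inj; rewrite e linear0. Qed.

(** All five have trace 0. [S1, S2] = 2(E12 - E21) and [T1, T2] = 2(E23 - E32), so [D12] and [D23]
    come from two rotations that do not commute; the entries tested below are non-zero entries of
    their action on S1. U acts as the identity on the upper left block, which contains S1. *)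
Definition tS1 : seq (seq int) := [:: [:: 1; 0; 0]; [:: 0; -1; 0]; [:: 0; 0; 0]].
Definition tS2 : seq (seq int) := [:: [:: 0; 1; 0]; [:: 1; 0; 0]; [:: 0; 0; 0]].
Definition tT1 : seq (seq int) := [:: [:: 0; 0; 0]; [:: 0; 1; 0]; [:: 0; 0; -1]].
Definition tT2 : seq (seq int) := [:: [:: 0; 0; 0]; [:: 0; 0; 1]; [:: 0; 1; 0]].
Definition tU : seq (seq int) := [:: [:: 1; 0; 0]; [:: 0; 1; 0]; [:: 0; 0; -2]].

Lemma S1T : (int_mx tS1)^T = int_mx tS1.
Proof. by apply/matrixP => -[[|[|[|//]]] ?] [[|[|[|//]]] ?]; rewrite !mxE. Qed.
Lemma S2T : (int_mx tS2)^T = int_mx tS2.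
Proof. by apply/matrixP => -[[|[|[|//]]] ?] [[|[|[|//]]] ?]; rewrite !mxE. Qed.
Lemma T1T : (int_mx tT1)^T = int_mx tT1.
Proof. by apply/matrixP => -[[|[|[|//]]] ?] [[|[|[|//]]] ?]; rewrite !mxE. Qed.
Lemma T2T : (int_mx tT2)^T = int_mx tT2.
Proof. by apply/matrixP => -[[|[|[|//]]] ?] [[|[|[|//]]] ?]; rewrite !mxE. Qed.
Lemma UT : (int_mx tU)^T = int_mx tU.
Proof. by apply/matrixP => -[[|[|[|//]]] ?] [[|[|[|//]]] ?]; rewrite !mxE. Qed.

Lemma int_mx_tr0 t : nth 0 (nth [::] t 0) 0 + nth 0 (nth [::] t 1) 1
    + nth 0 (nth [::] t 2) 2 = 0 -> \tr (int_mx t) = 0.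
Proof.
move=> t0; rewrite /mxtrace !big_ord_recr big_ord0 /= !mxE add0r -!intrD.
exact: (congr1 (fun z => z%:~R : F) t0).
Qed.

Lemma jscalar_J0 t : (int_mx t)^T = int_mx t -> \tr (int_mx t) = 0 ->
  jscalar (int_mx t) \in J0 C.
Proof. by move=> tT t0; rewrite mem_J0 jtr_jscalar // t0. Qed.

Lemma S1J0 : jscalar (int_mx tS1) \in J0 C.
Proof. by apply: jscalar_J0; [exact: S1T | exact: int_mx_tr0]. Qed.
Lemma S2J0 : jscalar (int_mx tS2) \in J0 C.
Proof. by apply: jscalar_J0; [exact: S2T | exact: int_mx_tr0]. Qed.
Lemma UJ0 : jscalar (int_mx tU) \in J0 C.
Proof. by apply: jscalar_J0; [exact: UT | exact: int_mx_tr0]. Qed.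

Lemma jscalar_neq0 t i j : (int_mx t)^T = int_mx t -> (i < 3)%N -> (j < 3)%N ->
  nth 0 (nth [::] t i) j != 0 -> jscalar (int_mx t) != 0.
Proof.
move=> tT i3 j3 tij; apply: contraNneq (scalar_mat_neq0 (int_mx_neq0 i3 j3 tij)) => e.
by rewrite -jscalarK // e.
Qed.

Lemma quarter_neq0 : 2%:R^-1 * 2%:R^-1 != 0 :> F.
Proof. by rewrite mulf_neq0 // invr_eq0 (natS_neq0 charF0 1). Qed.

Let D12 := jad (int_mx tS1) (int_mx tS2).
Let D23 := jad (int_mx tT1) (int_mx tT2).

Lemma D12_S1_neq0 : D12 (jscalar (int_mx tS1)) != 0.
Proof.
apply/eqP => /(congr1 vsval); rewrite jadE ?S1T ?S2T // jscalarK ?S1T // mad_scalar.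
rewrite !(int_mx_mul, int_mx_sub) => /eqP; rewrite scaler_eq0 (negbTE quarter_neq0) /=.
apply/negP/scalar_mat_neq0; apply: (@int_mx_neq0 _ 0 1) => //.
Qed.

Lemma D12_J0 : jtr (D12 (jscalar (int_mx tS1))) = 0.
Proof.
rewrite /jtr jadE ?S1T ?S2T // jscalarK ?S1T // mad_scalar linearZ /= mtr_scalar.
by rewrite !(int_mx_mul, int_mx_sub) int_mx_tr0 // scaler0.
Qed.

Lemma comm_D_neq0 : comm D12 D23 != 0.
Proof.
apply/eqP => /lfunP/(_ (jscalar (int_mx tS1)))/(congr1 vsval).
rewrite (comm_jad_jscalar S1T S2T T1T T2T S1T) zero_lfunE !(int_mx_mul, int_mx_sub) => /eqP.
rewrite !scaler_eq0 (negbTE quarter_neq0) /=.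
apply/negP/scalar_mat_neq0; apply: (@int_mx_neq0 _ 0 2) => //.
Qed.

Lemma inJ_eq0 D : inJ C D = 0 -> D = 0.
Proof. by rewrite inJE => -[]. Qed.

Lemma tens_ob_neq0 i (u : J) : u != 0 -> (0, tens (ob i) u, 0) != 0 :> amb.
Proof.
apply: contra => /eqP[/ffunP/(_ i)].
by rewrite !ffunE obE eqxx scale1r => ->.
Qed.

Lemma D12_der : D12 \in derJ C.
Proof. by apply: jad_der; [exact: S1T | exact: S2T]. Qed.
Lemma D23_der : D23 \in derJ C.
Proof. by apply: jad_der; [exact: T1T | exact: T2T]. Qed.

Lemma D12_neq0 : D12 != 0.
Proof. by apply: contraNneq D12_S1_neq0 => ->; rewrite lfunE. Qed.

(** The witnesses also have their bracket inside the component of degree i * j, as [graded_iso_perm]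
    needs in order to apply the isomorphism to it. *)
Lemma br_neq0 i j : exists x y : amb,
  [/\ x \in Lcomp C i, y \in Lcomp C j, br x y \in Lcomp C (star i j) & br x y != 0].
Proof.
have d0 k : 0 \in Dcomp F k := mem0v _.
case: (eqVneq i ord0) => [-> | i0]; case: (eqVneq j ord0) => [-> | j0].
- exists (inJ C D12), (inJ C D23).
  have cD : comm D12 D23 \in derJ C := der_comm D12_der D23_der.
  rewrite br_derJ starii; split; [exact: mem_Lcomp0 D12_der | exact: mem_Lcomp0 D23_der
    | exact: mem_Lcomp0 cD |].
  by apply: contraNneq comm_D_neq0 => /inJ_eq0->.
- exists (inJ C D12), (0, tens (ob j) (jscalar (int_mx tS1)), 0).
  rewrite br_JI star0l mem_Lcomp0 ?D12_der // !mem_Lcomp ?S1J0 // ?mem_J0 ?D12_J0 //.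
  by split=> //; apply: tens_ob_neq0 D12_S1_neq0.
- exists (0, tens (ob i) (jscalar (int_mx tS1)), 0), (inJ C D12).
  rewrite br_IJ star0 mem_Lcomp0 ?D12_der // -linearN.
  rewrite !mem_Lcomp ?S1J0 ?memvN // ?mem_J0 ?D12_J0 //.
  by split=> //; apply: tens_ob_neq0; rewrite oppr_eq0 D12_S1_neq0.
case: (eqVneq i j) => [<- | ij].
  (* With equal octonion factors the bracket is 2 t(e_i^2) [R_S1, R_S2] = -4 [D12]. *)
  exists (0, tens (ob i) (jscalar (int_mx tS1)), 0), (0, tens (ob i) (jscalar (int_mx tS2)), 0).
  rewrite br_II oD_self // scaler0 addr0 /ocomm subrr !lfunE !linear0l subrr addr0.
  rewrite -inJE starii !mem_Lcomp ?S1J0 ?S2J0 // mem_Lcomp0 ?memvZ ?D12_der //.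
  split=> //; apply/eqP => /inJ_eq0/eqP; apply/negP.
  rewrite scaler_eq0 negb_or D12_neq0 andbT omul_ob_sqr // linearN /= otr_ob eqxx.
  by rewrite mulrN oppr_eq0 -natrM (natS_neq0 charF0 3).
(* S1 . U = S1 has trace 0 and t(e_i e_j) = 0, so the bracket is the single tensor 2 e_i e_j (x)
   S1. *)
exists (0, tens (ob i) (jscalar (int_mx tS1)), 0), (0, tens (ob j) (jscalar (int_mx tU)), 0).
have SU : jmul (jscalar (int_mx tS1)) (jscalar (int_mx tU)) = jscalar (int_mx tS1).
  rewrite jmul_jscalar ?S1T ?UT //.
  have -> : int_mx tS1 *m int_mx tU = int_mx tS1.
    by rewrite int_mx_mul; congr int_mx; vm_compute.
  have -> : int_mx tU *m int_mx tS1 = int_mx tS1.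
    by rewrite int_mx_mul; congr int_mx; vm_compute.
  by rewrite -mulr2n -scaler_nat scalerA mulVf ?scale1r // (natS_neq0 charF0 1).
have /eqP S1tr : jtr (jscalar (int_mx tS1)) == 0 by rewrite -mem_J0 S1J0.
rewrite br_II /jstar SU S1tr mulr0 !scale0r subr0 linear0l !lfunE !linear0l subrr !add0r.
have -> : ocomm (ob i) (ob j) = (2%:R * osgn F i j) *: ob (star i j).
  by rewrite /ocomm (omul_ob_anticomm F j0 i0) 1?eq_sym // opprK omul_ob -mulr2n
     -scaler_nat scalerA.
have -> : otr (omul (ob i) (ob j)) = 0.
  by rewrite omul_ob linearZ /= otr_ob star_eq0 (negbTE ij) mul0rn scaler0.
rewrite mulr0 scale0r linearZl_LR -linearZr_LR /=.
rewrite !mem_Lcomp ?memvZ ?S1J0 ?UJ0 // ?star_eq0 //; split=> //.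
apply: tens_ob_neq0; rewrite scaler_eq0 negb_or mulf_neq0 ?(natS_neq0 charF0 1) //=.
  by rewrite (@jscalar_neq0 _ 0 0) ?S1T.
by rewrite osgnE signr_eq0.
Qed.

(** The permutation is read off from the images of the components; a non-zero bracket for each pair
    of degrees forces both the membership of pairs and the product of degrees to be carried
    along. *)
Lemma graded_iso_perm (T T' : {set {set 'I_8}}) : graded_iso C T T' ->
  exists s : 'I_8 -> 'I_8, [/\ injective s,
    forall i j, ([set i; j] \in T) = ([set s i; s j] \in T') &
    forall i j, [set i; j] \in T -> s (star i j) = star (s i) (s j)].
Proof.
case=> f [f_inj _ fbr fL].
have /fin_all_exists[s fs] : forall i, exists k, (f @: Lcomp C i)%VS = Lcomp C k := fL.
have sub i x : x \in Lcomp C i -> x \in TC C := subvP (Lcomp_sub_TC C i) x.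
have fLs i x : x \in Lcomp C i -> f x \in Lcomp C (s i).
  by rewrite -fs; apply: memv_img.
have f_neq0 i x : x \in Lcomp C i -> x != 0 -> f x != 0.
  move=> xi; apply: contra => /eqP fx0; apply/eqP/f_inj; rewrite ?linear0 ?mem0v //.
  exact: sub xi.
have brT1 (U : {set {set 'I_8}}) i j x y : x \in Lcomp C i -> y \in Lcomp C j ->
    brT U x y = if [set i; j] \in U then br x y else 0.
  by move=> xi yj; rewrite (brTE U xi yj) /eps; case: ifP; rewrite ?scale1r ?scale0r.
have TT' i j : [set i; j] \in T ->
    ([set s i; s j] \in T') && (s (star i j) == star (s i) (s j)).
  have [x [y [xi yj zk z0]]] := br_neq0 i j; move=> ij.
  have := fbr x y (sub _ _ xi) (sub _ _ yj).
  rewrite (brT1 _ _ _ _ _ xi yj) ij (brT1 _ _ _ _ _ (fLs _ _ xi) (fLs _ _ yj)).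
  case: ifP => [_ fz | _ fz]; last by have := f_neq0 _ _ zk z0; rewrite fz eqxx.
  (* The image of the bracket has degree s (i * j), and as a bracket of images it has degree s i * s
     j; if these differ, projecting shows it to be zero. *)
  apply: contraNT (f_neq0 _ _ zk z0) => sk.
  rewrite fz -(br_hom (fLs _ _ xi) (fLs _ _ yj)) -fz.
  by rewrite (hcomp_eq0 (fLs _ _ zk)) // eq_sym.
exists s; split=> [i k sik | i j | i j /TT'/andP[_ /eqP]//].
  apply/eqP; apply: contraT => ik.
  have [x [y [xi _ _ z0]]] := br_neq0 i i.
  have x0 : x != 0 by apply: contraNneq z0 => ->; rewrite br0l.
  have : f x \in (f @: Lcomp C k)%VS by rewrite fs -sik fLs.
  case/memv_imgP=> x' x'k /f_inj e; case/eqP: x0.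
  rewrite -(hcomp_id xi) e ?(sub _ _ xi) ?(sub _ _ x'k) //.
  exact: hcomp_eq0 x'k ik.
apply/idP/idP => [/TT'/andP[]// | sij].
(* For the converse the non-zero bracket is chosen in the target and its arguments are lifted
   through f, which maps each component onto its image component. *)
have [fx [fy [fxi fyj _ z0]]] := br_neq0 (s i) (s j).
move: fxi fyj z0; rewrite -!fs => /memv_imgP[x xi ->] /memv_imgP[y yj ->] z0.
have := fbr x y (sub _ _ xi) (sub _ _ yj).
rewrite (brT1 _ _ _ _ _ xi yj) (brT1 _ _ _ _ _ (fLs _ _ xi) (fLs _ _ yj)) sij.
by case: ifP => // _; rewrite linear0 => /esym/eqP; rewrite (negbTE z0).
Qed.

Lemma graded_iso_trans (T1 T2 T3 : {set {set 'I_8}}) :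
  graded_iso C T1 T2 -> graded_iso C T2 T3 -> graded_iso C T1 T3.
Proof.
move=> [f [f_inj fT fbr fL]] [h [h_inj hT hbr hL]].
have fTC x : x \in TC C -> f x \in TC C by rewrite -{2}fT; apply: memv_img.
exists (h \o f)%VF; split.
- by move=> x y xT yT; rewrite !comp_lfunE => /h_inj/f_inj-> //; apply: fTC.
- by rewrite limg_comp fT hT.
- by move=> x y xT yT; rewrite !comp_lfunE fbr // hbr ?fTC.
by move=> i; have [k fk] := fL i; have [l hl] := hL k; exists l; rewrite limg_comp fk.
Qed.

End ScalarMatrices.

Unset Implicit Arguments.

Theorem theorem4p10 (F : closedFieldType) (charF0 : [pchar F] =i pred0)
    (C : {vspace 'rV[F]_8}) (hC : C \in hurwitz F) :
  [/\ size representatives = 215%N,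
      uniq representatives,
      (forall T, T \in representatives -> generalised_nice T),
      (forall T, generalised_nice T ->
         exists2 T', T' \in representatives & graded_iso C T T')
    & (forall T T', T \in representatives -> T' \in representatives ->
         graded_iso C T T' -> T = T')].
Proof.
split; [exact: size_reps | exact: uniq_reps | exact: reps_nice | |].
  apply: nice_rep.
  - exact: graded_iso_trans.
  - by move=> s T; apply: collineation_iso.
  - by move=> T; apply: swap_iso.
move=> T T' TR T'R /(graded_iso_perm hC charF0)[s [s_inj ts ss]].
exact: (reps_noniso TR T'R s_inj ts ss).
Qed.
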